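(* Let $\mathcal C$ be a pure, flag simplicial complex without boundary, of dimension at most three. Then $\mathcal C$ is pure-EKR; that is, there is a vertex $v$ of $\mathcal C$ such that every intersecting family of facets of $\mathcal C$ has at most as many members as there are facets of $\mathcal C$ containing $v$.
   Context: A simplicial complex $\mathcal C$ is a family of subsets (faces, or simplices) of a finite ground set closed under taking subsets; its vertices are the elements $v$ with $\{v\}\in\mathcal C$, and we assume it has at least one vertex. The dimension of a face $\sigma$ is $|\sigma|-1$; the dimension of $\mathcal C$ is the maximum dimension of its faces. Facets are the inclusion-maximal faces. $\mathcal C$ is pure if all facets have the same size. $\mathcal C$ is flag if every set of vertices that pairwise span edges (faces of size two) is a face; equivalently, all inclusion-minimal non-faces (among sets of vertices) have size two. A pure complex is without boundary if every non-maximal simplex (face that is not a facet) is contained in at least two facets. A family of facets is intersecting if no two of its members are disjoint. A pure simplicial complex is pure-EKR if the maximum size of an intersecting family of facets is attained by the family of all facets containing $v$, for some vertex $v$. *)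

(* Defs.v *)
From mathcomp Require Import all_boot.

Set Implicit Arguments.
Unset Strict Implicit.
Unset Printing Implicit Defensive.

Definition vertices (T : finType) (C : {set {set T}}) : {set T} :=
  [set v | [set v] \in C].

Definition simplicial_complex (T : finType) (C : {set {set T}}) : Prop :=
  (forall s t : {set T}, s \in C -> t \subset s -> t \in C)
  /\ (exists v, v \in vertices C).

(* The truncated predecessor gives the empty face dimension 0 instead of -1;
   since a simplicial complex has a vertex, the maximum below is unaffected. *)
Definition face_dim (T : finType) (s : {set T}) : nat := #|s|.-1.

Definition dim (T : finType) (C : {set {set T}}) : nat :=
  \max_(s in C) face_dim s.

Definition facets (T : finType) (C : {set {set T}}) : {set {set T}} :=
  [set s | maxset (fun t => t \in C) s].

Definition pure (T : finType) (C : {set {set T}}) : Prop :=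
  {in facets C &, forall s t : {set T}, #|s| = #|t|}.

Definition flag (T : finType) (C : {set {set T}}) : Prop :=
  forall S : {set T}, S \subset vertices C ->
    {in S &, forall x y, x != y -> [set x; y] \in C} -> S \in C.

(* The empty face is one of the simplices quantified over here. *)
Definition without_boundary (T : finType) (C : {set {set T}}) : Prop :=
  forall s : {set T}, s \in C -> s \notin facets C ->
    2 <= #|[set t in facets C | s \subset t]|.

Definition intersecting (T : finType) (F : {set {set T}}) : Prop :=
  {in F &, forall s t : {set T}, s != t -> ~~ [disjoint s & t]}.

Definition facets_at (T : finType) (C : {set {set T}}) (v : T) :
  {set {set T}} := [set s in facets C | v \in s].

(* As facets_at C v is itself intersecting, this bound says that it attains
   the maximum size of an intersecting family of facets. *)
Definition pure_EKR (T : finType) (C : {set {set T}}) : Prop :=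
  exists2 v, v \in vertices C &
    forall F : {set {set T}}, F \subset facets C -> intersecting F ->
      #|F| <= #|facets_at C v|.

(* Main.v *)
Require Import Defs.
From mathcomp Require Import all_boot.
From mathcomp Require Import zify.

(** Five distinct vertices are never pairwise adjacent, because faces have at
most four vertices and the complex is flag.  And any vertex [x] of a facet [p]
can be exchanged for another one, since the ridge [p] minus [x] lies in a second
facet [flip x p]; the new vertex is not adjacent to [x], or else it could be
added to [p].  Hence [p] can be recovered from [flip x p], flipping at [x] is
injective, and it does not touch the neighbours of [x].  Most counting arguments
below combine such injections, and most structural arguments end with five
pairwise adjacent vertices.

Two adjacent stars ([two_stars]).  Assume that all members of an intersecting
family meet the edge [xy].  The members through [x] only and those through [y]
only are cross-intersecting, and they can only meet in the common neighbours
of [x] and [y], which span a triangle-free graph.  So either some vertex is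
common to one of the two classes, or the classes trace the two perfect
matchings of a 4-cycle.  In each case flips show that the two classes fill
proportions of their surroundings that add up to at most one, so that the
family is no larger than the star of [x] or that of [y].

Now let [F] be a maximum intersecting family, and assume that it is larger than
every star.  By the above no edge meets all members of [F], and trading the
members disjoint from an edge for all facets through this edge makes the family
strictly smaller ([switch_edge]).

If some triangle meets all members, take [xyz] among such triangles in the
largest number of facets.  Trading along its edges shows first that no member
contains exactly two of its vertices ([heavy_trace2_eq0]), then that for each
of its vertices the members through this vertex alone are more numerous than
the facets through any triangle meeting all members ([heavy_trace1_big]).
But the three classes are pairwise cross-intersecting, and the 4-cycles of the
previous analysis leave at most two members in one class ([no_heavy]).

If no triangle meets all members, then two members share at most two vertices
([F_share3]).  Take a vertex [x].  When a member [p] avoiding [x] has three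
neighbours of [x], these and [x] form a facet outside [F], and this facet
determines [p].  This yields an injection from the members avoiding [x] to the
facets through [x] outside [F], which would make the star of [x] at least as large
as [F]; it extends to members with two neighbours of [x] as long as [x] lies in
at least four members ([trace_injection]).  So every vertex lies in few
members, and counting the members along the vertices of a single one gives
at most eight, whereas some star has at least eight facets ([F_card_gt8]). *)

Set Implicit Arguments.
Unset Strict Implicit.
Unset Printing Implicit Defensive.

(** * A counting principle *)

Lemma card_le_fibers (I J K : finType) (A : {set I}) (B : {set J})
    (f : I -> K) (g : J -> K) :
  (forall k, #|[set a in A | f a == k]| <= #|[set b in B | g b == k]|) ->
  #|A| <= #|B|.
Proof.
move=> le_fib; rewrite -!sum1_card.
rewrite (partition_big f predT) //= [leqRHS](partition_big g predT) //=.
apply: leq_sum => k _; move: (le_fib k); rewrite -!sum1_card.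
by congr (_ <= _); apply: eq_bigl => i; rewrite inE.
Qed.

(** * Cliques and facets *)

Section FlagComplex.

Variables (T : finType) (C : {set {set T}}).
Hypotheses (Ccx : simplicial_complex C) (Cpure : pure C) (Cflag : flag C).
Hypotheses (Cnb : without_boundary C) (Cdim : dim C <= 3).

Implicit Types (x y z a b c e u v w : T) (p q r s : {set T}).

(** Taking [x = y] makes every vertex adjacent to itself, so that faces are exactly
the sets on which [adj] holds everywhere, and [adj x x] says that [x] is a
vertex. *)
Definition adj x y := [set x; y] \in C.

Lemma adjC x y : adj x y = adj y x.
Proof. by rewrite /adj setUC. Qed.

Lemma face_sub s p : s \in C -> p \subset s -> p \in C.
Proof. by case: Ccx => + _; apply. Qed.

Lemma face_adj s x y : s \in C -> x \in s -> y \in s -> adj x y.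
Proof.
move=> sC xs ys; apply: face_sub sC _.
by apply/subsetP => v; rewrite !inE => /orP[] /eqP->.
Qed.

Lemma clique_face s : {in s &, forall x y, adj x y} -> s \in C.
Proof.
move=> adjs; apply: Cflag => [|x y xs ys _]; last exact: adjs.
by apply/subsetP => x xs; rewrite inE; move: (adjs x x xs xs);
   rewrite /adj setUid.
Qed.

Lemma face_card s : s \in C -> #|s| <= 4.
Proof.
move=> sC; have: face_dim s <= dim C by exact: leq_bigmax_cond.
by rewrite /face_dim; lia.
Qed.

Lemma facetP p :
  reflect (p \in C /\ forall s, s \in C -> p \subset s -> s = p)
          (p \in facets C).
Proof. by rewrite inE; apply: maxsetP. Qed.

Lemma facet_face p : p \in facets C -> p \in C.
Proof. by case/facetP. Qed.

Lemma facet_adj p x y : p \in facets C -> x \in p -> y \in p -> adj x y.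
Proof. by move/facet_face; apply: face_adj. Qed.

Lemma face_in_facet s : s \in C -> exists2 p, p \in facets C & s \subset p.
Proof.
move=> sC; have [p pmax sp] := maxset_exists (P := fun t => t \in C) sC.
by exists p => //; rewrite inE.
Qed.

Lemma facet_neq0 p : p \in facets C -> exists x, x \in p.
Proof.
case/facetP => pC pmax; case: Ccx => _ [v]; rewrite inE => vC.
have [p0|/set0Pn//] := eqVneq p set0.
by exists v; rewrite -(pmax _ vC) ?p0 ?sub0set ?set11.
Qed.

(** Adding such a vertex to [p] would give a larger clique, hence a larger
face. *)
Lemma facet_max p v : p \in facets C -> {in p, forall u, adj u v} -> v \in p.
Proof.
move=> pF adjv; have [x xp] := facet_neq0 pF; have [pC pmax] := facetP _ pF.
rewrite -(pmax (v |: p)) ?setU11 ?subsetUr //; apply: clique_face => a b.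
have avv : adj v v.
  by apply: (face_adj (adjv _ xp)); rewrite !inE eqxx ?orbT.
by rewrite !inE => /predU1P[->|ap] /predU1P[->|bp] //;
  [rewrite adjC| |]; auto; apply: facet_adj bp.
Qed.

Lemma card4_facet p : p \in C -> #|p| = 4 -> p \in facets C.
Proof.
move=> pC p4; apply/facetP; split=> // s sC ps.
by apply/esym/eqP; rewrite eqEcard ps p4 face_card.
Qed.

(** The length condition is needed because a list of one element says nothing
about that element being a vertex. *)
Lemma pairwise_face (s : seq T) : 1 < size s -> pairwise adj s ->
  [set x in s] \in C.
Proof.
move=> s2 adjs; apply: clique_face => x y; rewrite !inE.
have ladj i j : i < j -> j < size s -> adj (nth x s i) (nth x s j).
  move=> ij js; move/pairwiseP: adjs; move/(_ x i j); apply => //.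
  by rewrite inE (ltn_trans ij).
move=> /(nthP x)[i si <-] /(nthP x)[j sj <-].
have [ij|ji|->] := ltngtP i j; [exact: ladj | by rewrite adjC; apply: ladj|].
have [j0|j0] := posnP j.
  by apply: (face_adj (ladj 0 1 isT s2)); rewrite j0 !inE eqxx.
by apply: (face_adj (ladj 0 j j0 sj)); rewrite !inE eqxx ?orbT.
Qed.

Lemma no_clique5 a b c d e :
  adj a b -> adj a c -> adj a d -> adj a e -> adj b c -> adj b d -> adj b e ->
  adj c d -> adj c e -> adj d e ->
  a != b -> a != c -> a != d -> a != e -> b != c -> b != d -> b != e ->
  c != d -> c != e -> d != e -> False.
Proof.
move=> ab ac ad ae bc bd be cd ce de nab nac nad nae nbc nbd nbe ncd nce nde.
have: [set x in [:: a; b; c; d; e]] \in C.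
  by apply: pairwise_face => //=; do ![apply/andP; split=> //].
move/face_card; rewrite cardsE; have /card_uniqP-> // : uniq [:: a; b; c; d; e].
rewrite /= !inE !negb_or; by do ![apply/andP; split=> //].
Qed.

(** * Flips *)

Definition flip x p :=
  odflt p [pick q in facets C | (p :\ x \subset q) && (q != p)].

Lemma flipP p x : p \in facets C -> x \in p ->
  [/\ flip x p \in facets C, p :\ x \subset flip x p & flip x p != p].
Proof.
move=> pF xp; rewrite /flip; case: pickP => [q /and3P[]//|none].
have pxC : p :\ x \in C by apply: face_sub (facet_face pF) (subD1set _ _).
have pxF : p :\ x \notin facets C.
  apply/negP => /facetP[_ /(_ _ (facet_face pF) (subD1set _ _)) E].
  by move: xp; rewrite E !inE eqxx.
have := Cnb pxC pxF; rewrite leqNgt => /negP[]; rewrite ltnS.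
rewrite -(cards1 p); apply/subset_leq_card/subsetP => q; rewrite !inE.
move=> /andP[qF pq]; move: (none q); rewrite inE qF pq /=.
by move/negbFE.
Qed.

Lemma flip_facet p x : p \in facets C -> x \in p -> flip x p \in facets C.
Proof. by move=> pF xp; case: (flipP pF xp). Qed.

(** By purity [q] is [p] with [x] replaced by [v]; a vertex [v] adjacent to [x]
would then be adjacent to all of [p]. *)
Lemma new_vertex_nonadj p q x : p \in facets C -> q \in facets C ->
    p :\ x \subset q -> q != p -> x \in p ->
  forall v, v \in q -> v \notin p -> ~~ adj x v.
Proof.
move=> pF qF pq qp xp v vq vp; apply/negP => axv.
have xq : x \notin q.
  apply: contra qp => xq; have [_ pmax] := facetP _ pF; apply/eqP/pmax.
    exact: facet_face.
  by apply/subsetP => w wp; have [->//|wx] := eqVneq w x;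
     apply: (subsetP pq); rewrite !inE wx.
have qE : q = v |: (p :\ x).
  apply/esym/eqP; rewrite eqEcard; apply/andP; split.
    by rewrite subUset sub1set vq.
  rewrite cardsU1 !inE (negPf vp) andbF /= add1n.
  by rewrite (Cpure qF pF) (cardsD1 x p) xp.
move: vp; apply/negP; rewrite negbK; apply: facet_max pF _ => w wp.
have [->//|wx] := eqVneq w x.
by apply: (facet_adj qF) => //; rewrite qE !inE wx wp orbT.
Qed.

Lemma flip_notin p x : p \in facets C -> x \in p -> x \notin flip x p.
Proof.
move=> pF xp; have [qF pq qp] := flipP pF xp.
apply: contra qp => xq; have [_ pmax] := facetP _ pF; apply/eqP/pmax.
  exact: facet_face.
by apply/subsetP => w wp; have [->//|wx] := eqVneq w x;
   apply: (subsetP pq); rewrite !inE wx.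
Qed.

(** Among the neighbours of [x] a flip at [x] changes nothing: what it adds is
not adjacent to [x].  This is why a flip respects any prescribed pattern on
neighbours of [x]. *)
Lemma flip_mem p x v : p \in facets C -> x \in p -> adj x v -> v != x ->
  (v \in flip x p) = (v \in p).
Proof.
move=> pF xp axv vx; have [qF pq qp] := flipP pF xp.
apply/idP/idP => [vq|vp]; last by apply: (subsetP pq); rewrite !inE vx.
by apply: contraLR axv => vp; apply: (new_vertex_nonadj pF qF).
Qed.

(** Indeed [p] consists of [x] and its neighbours in [flip x p]. *)
Lemma flip_inj p q x : p \in facets C -> q \in facets C -> x \in p -> x \in q ->
  flip x p = flip x q -> p = q.
Proof.
move=> pF qF xp xq E; apply/setP => v.
have [->|vx] := eqVneq v x; first by rewrite xp xq.
have [axv|naxv] := boolP (adj x v).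
  by rewrite -(flip_mem pF xp axv vx) E flip_mem.
have notin r : r \in facets C -> x \in r -> (v \in r) = false.
  by move=> rF xr; apply: contraNF naxv; apply: facet_adj.
by rewrite !notin.
Qed.

Lemma flip_count x (A B : {set {set T}}) :
    {in A, forall p, [/\ p \in facets C, x \in p & flip x p \in B]} ->
  #|A| <= #|B|.
Proof.
move=> AB; have finj : {in A &, injective (flip x)}.
  by move=> p q /AB[pF xp _] /AB[qF xq _]; apply: flip_inj.
rewrite -(card_in_imset finj); apply/subset_leq_card/subsetP => q.
by case/imsetP => p /AB[_ _ ?] ->.
Qed.


(** * Adjacency reasoning *)

Ltac lia_goal := repeat match goal with H : _ |- _ => clear H end; lia.

Lemma neq_in p a b : a \in p -> b \notin p -> a != b.
Proof. by move=> ap; apply: contraNneq => <-. Qed.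

Lemma neq_adj e a b : adj e a -> ~~ adj e b -> a != b.
Proof. by move=> ea; apply: contraNneq => <-. Qed.

(** Closing side conditions: two vertices of a common facet are adjacent, and
two vertices separated by a set or by adjacency to a third one are distinct.
With these, [clique5_tac] derives a contradiction from five vertices. *)
Ltac facet_tac := first [assumption |
  match goal with
  | S : sub_mem (@mem _ _ (@pred_of_set _ ?F)) _,
    H : is_true (@in_mem _ ?p (@mem _ _ (@pred_of_set _ ?F)))
    |- is_true (@in_mem _ ?p _) =>
    exact (S _ H)
  end].

Ltac adj_tac :=
  match goal with |- is_true (adj ?x ?y) => first
  [ assumption | rewrite adjC; assumption
  | match goal with
    | Hx : is_true (@in_mem _ x (@mem _ _ (@pred_of_set _ ?p))),
      Hy : is_true (@in_mem _ y (@mem _ _ (@pred_of_set _ ?p))) |- _ =>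
        apply: (@facet_adj p x y _ Hx Hy); facet_tac
    end ]
  end.

Ltac neq_tac1 :=
  match goal with |- is_true (negb (?a == ?b)) => first
  [ assumption
  | match goal with
    | Ha : is_true (@in_mem _ a (@mem _ _ (@pred_of_set _ ?p))),
      Hb : is_true (~~ @in_mem _ b (@mem _ _ (@pred_of_set _ ?p))) |- _ =>
        exact (@neq_in p a b Ha Hb)
    end
  | match goal with
    | Hb : is_true (~~ adj b ?e) |- _ =>
        apply: (@neq_adj e); [adj_tac | rewrite adjC; exact Hb]
    | Hb : is_true (~~ adj ?e b) |- _ =>
        apply: (@neq_adj e); [adj_tac | exact Hb]
    end ]
  end.

Ltac neq_tac := first [neq_tac1 | rewrite eq_sym; neq_tac1].

Ltac clique5_tac a b c d e :=
  exfalso; apply: (@no_clique5 a b c d e); try first [adj_tac | neq_tac].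

(** The vertices of the link of the edge [xy]; by flagness these are just the
common neighbours. *)
Definition link x y := [set e | [&& adj x e, adj y e, e != x & e != y]].

Lemma linkP x y e :
  reflect [/\ adj x e, adj y e, e != x & e != y] (e \in link x y).
Proof. by rewrite inE; apply: and4P. Qed.

Lemma linkC x y : link x y = link y x.
Proof. by apply/setP => e; rewrite !inE andbCA; congr (_ && (_ && _)); apply: andbC. Qed.

(** Two candidates would both lie in [q], hence be adjacent to each other as well
as to [a], [b] and [c].  So members that must meet [q] in the link of a triangle
all meet it in the same vertex. *)
Lemma common_meet (A : {set {set T}}) q a b c p0 :
    q \in facets C -> a != b -> a != c -> b != c ->
    adj a b -> adj a c -> adj b c -> p0 \in A ->
    {in A, forall p, exists e, [/\ e \in p, e \in q, e \in link a b & e \in link b c]} ->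
  exists e, [/\ e \in q, e \in link a b, e \in link b c & {in A, forall p, e \in p}].
Proof.
move=> qF nab nac nbc ab ac bc p0A meet.
have [e [_ eq eab ebc]] := meet _ p0A; exists e; split=> // p pA.
have [e' [e'p e'q e'ab e'bc]] := meet _ pA.
have [->//|ne] := eqVneq e e'.
have [? ? ? ?] := linkP _ _ _ eab; have [_ ? _ ?] := linkP _ _ _ ebc.
have [? ? ? ?] := linkP _ _ _ e'ab; have [_ ? _ ?] := linkP _ _ _ e'bc.
by clique5_tac a b c e e'.
Qed.

Lemma link_triangle_free x y u v w : x != y -> adj x y ->
  u \in link x y -> v \in link x y -> w \in link x y ->
  adj u v -> adj u w -> adj v w -> u != v -> u != w -> v = w.
Proof.
move=> nxy xy /linkP[? ? ? ?] /linkP[? ? ? ?] /linkP[? ? ? ?] uv uw vw nuv nuw.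
by apply/eqP/negP => /negP nvw; clique5_tac x y u v w.
Qed.

(** A facet has at most two vertices in the link of an edge, as this link has no
triangle. *)
Lemma trace_le2 q x y u : q \in facets C -> x != y -> adj x y ->
  u \in q -> u \in link x y ->
  exists v, [/\ v \in q, v \in link x y &
             forall e, e \in q -> e \in link x y -> e = u \/ e = v].
Proof.
move=> qF nxy xy uq uL.
have [v /andP[vq /andP[vL nvu]]|none] :=
    pickP [pred v | (v \in q) && ((v \in link x y) && (v != u))].
- exists v; split=> // e eq eL.
  have [->|neu] := eqVneq e u; [by left | right].
  have [? ? ?] : [/\ adj u v, adj u e & adj v e] by split; adj_tac.
  by apply/esym/(link_triangle_free nxy xy uL vL eL) => //; rewrite eq_sym.
exists u; split=> // e eq eL; left; apply/eqP.
by move: (none e); rewrite /= eq eL => /negbFE.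
Qed.

(** * Cross-intersecting families at an edge *)

Definition crossing x y (A B : {set {set T}}) :=
  [/\ {in A, forall p, [/\ p \in facets C, x \in p & y \notin p]},
      {in B, forall q, [/\ q \in facets C, y \in q & x \notin q]}
    & {in A & B, forall p q, exists2 e, e \in p & e \in q}].

Lemma crossingC x y A B : crossing x y A B -> crossing y x B A.
Proof.
by case=> hA hB h; split=> // p q pB qA; have [e] := h _ _ qA pB; exists e.
Qed.

Lemma crossing_meet x y A B p q : crossing x y A B -> p \in A -> q \in B ->
  exists e, [/\ e \in p, e \in q & e \in link x y].
Proof.
case=> hA hB h pA qB; have [e ep eq] := h _ _ pA qB; exists e; split=> //.
have [pF xp yp] := hA _ pA; have [qF yq xq] := hB _ qB.
by apply/linkP; split; [adj_tac | adj_tac | neq_tac | neq_tac].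
Qed.

(** The vertices [x], [y], [c] form a triangle and all members of [A] must meet [q]
in its link. *)
Lemma crossing_share x y A B c p0 q : x != y -> adj x y -> crossing x y A B ->
    p0 \in A -> c \in link x y -> {in A, forall p, c \in p} -> q \in B -> c \notin q ->
  exists e, [/\ e \in q, e \in link x y, e \in link y c & {in A, forall p, e \in p}].
Proof.
move=> nxy xy cr p0A /linkP[xc yc ncx ncy] cA qB cq; have [hA hB _] := cr.
have [p0F xp0 yp0] := hA _ p0A; have [qF yq xq] := hB _ qB.
have cp0 := cA _ p0A.
apply: (common_meet (p0 := p0) qF nxy _ _ xy xc yc p0A) => //; [neq_tac|neq_tac|].
move=> p pA; have [e [ep eq /linkP[ex ey nex ney]]] := crossing_meet cr pA qB.
have [pF xp yp] := hA _ pA; have cp := cA _ pA.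
exists e; split=> //; first by apply/linkP.
by apply/linkP; split=> //; [adj_tac|neq_tac].
Qed.

(** Without common vertices, the traces in the link of [xy] are edges.  Those of
two members of [B], one avoiding [v1] and one avoiding [u1], are disjoint, and a
trace of [A] takes one end of each; absence of triangles leaves two choices. *)
Lemma four_cycle x y A B p0 q0 : x != y -> adj x y -> crossing x y A B ->
    p0 \in A -> q0 \in B ->
    {in link x y, forall c, exists2 p, p \in A & c \notin p} ->
    {in link x y, forall c, exists2 q, q \in B & c \notin q} ->
  exists u1 v1 u2 v2,
    [/\ u1 \in link x y, v1 \in link x y, u2 \in link x y & v2 \in link x y] /\
    [/\ u1 != v1, u2 != v2, adj u1 v1 & adj u2 v2] /\
    [/\ ~~ adj u1 v2, ~~ adj v1 u2 &
    {in A, forall p, [/\ u1 \in p, v1 \in p, u2 \notin p & v2 \notin p] \/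
                     [/\ u1 \notin p, v1 \notin p, u2 \in p & v2 \in p]}].
Proof.
move=> nxy xy cr p0A q0B ncA ncB; have [hA hB _] := cr.
have [p0F xp0 yp0] := hA _ p0A.
have [u1 [u1p0 _ u1L]] := crossing_meet cr p0A q0B.
have [v1 [v1p0 v1L tr0]] := trace_le2 p0F nxy xy u1p0 u1L.
have hit0 q : q \in B -> u1 \in q \/ v1 \in q.
  move=> qB; have [e [ep0 eq eL]] := crossing_meet cr p0A qB.
  by case: (tr0 e ep0 eL) => <-; [left | right].
have [q1 q1B v1q1] := ncB _ v1L; have [q2 q2B u1q2] := ncB _ u1L.
have u1q1 : u1 \in q1 by case: (hit0 _ q1B) => //; rewrite (negPf v1q1).
have v1q2 : v1 \in q2 by case: (hit0 _ q2B) => //; rewrite (negPf u1q2).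
have [q1F yq1 xq1] := hB _ q1B; have [q2F yq2 xq2] := hB _ q2B.
have [u2 [u2q1 u2L tr1]] := trace_le2 q1F nxy xy u1q1 u1L.
have [v2 [v2q2 v2L tr2]] := trace_le2 q2F nxy xy v1q2 v1L.
have hit1 p : p \in A -> u1 \in p \/ u2 \in p.
  move=> pA; have [e [ep eq eL]] := crossing_meet cr pA q1B.
  by case: (tr1 e eq eL) => <-; [left | right].
have hit2 p : p \in A -> v1 \in p \/ v2 \in p.
  move=> pA; have [e [ep eq eL]] := crossing_meet cr pA q2B.
  by case: (tr2 e eq eL) => <-; [left | right].
have trifree := link_triangle_free nxy xy.
have [p1 p1A u1p1] := ncA _ u1L; have [p1F _ _] := hA _ p1A.
have u2p1 : u2 \in p1 by case: (hit1 _ p1A) => //; rewrite (negPf u1p1).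
have [p2 p2A v1p2] := ncA _ v1L; have [p2F _ _] := hA _ p2A.
have v2p2 : v2 \in p2 by case: (hit2 _ p2A) => //; rewrite (negPf v1p2).
have nu12 : u1 != u2 by neq_tac.
have nv12 : v1 != v2 by neq_tac.
have nuv : u1 != v1 by neq_tac.
have nu2v1 : u2 != v1 by neq_tac.
have nu1v2 : u1 != v2 by neq_tac.
have a12 : adj u1 v2 = false.
  apply/negP => a; have := trifree u1 v1 v2 u1L v1L v2L; rewrite (negPf nuv).
  by move=> /(_ _ _ _ isT nu1v2)-E; move/eqP: nv12; apply; apply: E; adj_tac.
have a21 : adj v1 u2 = false.
  apply/negP => a; have := trifree v1 u1 u2 v1L u1L u2L; rewrite eq_sym nuv.
  rewrite eq_sym nu2v1 => E; move/eqP: nu12; apply; apply: E => //; adj_tac.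
exists u1, v1, u2, v2; split; first by split.
have main p : p \in A -> [/\ u1 \in p, v1 \in p, u2 \notin p & v2 \notin p] \/
                     [/\ u1 \notin p, v1 \notin p, u2 \in p & v2 \in p].
  move=> pA; have [pF _ _] := hA _ pA.
  have ex1 : u1 \in p -> v2 \notin p.
    by move=> u1p; apply/negP => v2p; move/negP: a12; apply; adj_tac.
  have ex2 : v1 \in p -> u2 \notin p.
    by move=> u1p; apply/negP => v2p; move/negP: a21; apply; adj_tac.
  case: (hit1 p pA) (hit2 p pA) => h1 [] h2.
  - by left; split; auto.
  - by move: (ex1 h1); rewrite h2.
  - by move: (ex2 h2); rewrite h1.
  - right; split=> //; first by apply: contraL h2; apply: ex1.
    by apply: contraL h1; apply: ex2.
have v12 : adj v1 v2 by adj_tac.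
split; last by split; rewrite ?a12 ?a21.
split=> //; [by apply: contraFneq a21 => -> | adj_tac |].
by case: (main p1 p1A) => -[]; [rewrite (negPf u1p1) | move=> *; adj_tac].
Qed.

(** * Two adjacent stars *)

Definition only x y := [set p in facets C | (x \in p) && (y \notin p)].

Lemma flip_half a (X : {set {set T}}) :
    {in X, forall p, p \in facets C} ->
    {in X, forall p, a \in p -> flip a p \in X} ->
  #|[set p in X | a \in p]| <= #|[set p in X | a \notin p]|.
Proof.
move=> XF Xflip; apply: (@flip_count a) => p; rewrite inE => /andP[pX ap].
by have pF := XF _ pX; split=> //; rewrite inE Xflip ?flip_notin.
Qed.

Lemma card_split a (X : {set {set T}}) :
  #|X| = #|[set p in X | a \in p]| + #|[set p in X | a \notin p]|.
Proof.
rewrite -(cardsID [set p : {set T} | a \in p] X); congr (_ + _); apply: eq_card => p.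
  by rewrite !inE.
by rewrite !inE andbC.
Qed.

Lemma only_facet x y : {in only x y, forall p, p \in facets C}.
Proof. by move=> p; rewrite inE => /andP[]. Qed.

Lemma only_flip x y a : a \in link x y ->
  {in only x y, forall p, a \in p -> flip a p \in only x y}.
Proof.
move=> /linkP[? ? ? ?] p; rewrite inE => /and3P[pF xp yp] ap; rewrite inE.
rewrite flip_facet //= !flip_mem ?xp //; [adj_tac|neq_tac|adj_tac|neq_tac].
Qed.

Lemma only_half x y a (A : {set {set T}}) : a \in link x y ->
  A \subset only x y -> {in A, forall p, a \in p} -> #|A|.*2 <= #|only x y|.
Proof.
move=> aL AX aA; have := flip_half (@only_facet x y) (only_flip aL).
rewrite (card_split a (only x y)).
have : #|A| <= #|[set p in only x y | a \in p]|.
  by apply/subset_leq_card/subsetP => p pA; rewrite inE (subsetP AX) ?aA.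
lia_goal.
Qed.

(** With [nab], [na], [nb], [n0] counting the facets of [only x y] by their trace
on the edge [ab], flips at [a] and [b] order these four numbers.  Thus those
containing [ab] make up at most a quarter, those meeting [ab] at most three
quarters. *)
Lemma only_patterns x y a b : a \in link x y -> b \in link x y -> adj a b ->
  a != b ->
  exists nab na nb n0,
  [/\ #|only x y| = nab + na + nb + n0,
      nab <= na /\ nab <= nb, na <= n0 /\ nb <= n0,
      forall A : {set {set T}}, A \subset only x y ->
        {in A, forall p, (a \in p) && (b \in p)} -> #|A| <= nab &
      forall A : {set {set T}}, A \subset only x y ->
        {in A, forall p, (a \in p) || (b \in p)} -> #|A| <= nab + na + nb].
Proof.
move=> aL bL ab nab.
pose N (P Q : pred {set T}) := #|[set p in only x y | P p && Q p]|.
pose ia (p : {set T}) := a \in p; pose ib (p : {set T}) := b \in p.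
pose oa (p : {set T}) := a \notin p; pose ob (p : {set T}) := b \notin p.
have le (c : T) (P Q R S : pred {set T}) : c \in link x y ->
    (forall p, p \in facets C -> P p -> Q p -> [/\ c \in p, R (flip c p) & S (flip c p)]) ->
    N P Q <= N R S.
  move=> cL h; apply: (@flip_count c) => p; rewrite inE => /andP[pX /andP[Pp Qp]].
  have pF := only_facet pX; have [cp Rp Sp] := h _ pF Pp Qp.
  by split=> //; rewrite inE (only_flip cL) // Rp Sp.
have fa p : p \in facets C -> a \in p -> (b \in flip a p) = (b \in p).
  by move=> *; rewrite flip_mem // eq_sym.
have fb p : p \in facets C -> b \in p -> (a \in flip b p) = (a \in p).
  by move=> *; rewrite flip_mem // adjC.
exists (N ia ib), (N ia ob), (N oa ib), (N oa ob); split.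
- rewrite (card_split a) (card_split b [set p in only x y | a \in p]).
  rewrite (card_split b [set p in only x y | a \notin p]) !addnA.
  by congr (_ + _ + _ + _); apply: eq_card => p; rewrite !inE -!andbA.
- split; [apply: (le b) | apply: (le a)] => // p pF; rewrite /ia /ib /oa /ob.
    by move=> ap bp; rewrite fb ?flip_notin.
  by move=> ap bp; rewrite fa ?flip_notin.
- split; [apply: (le a) | apply: (le b)] => // p pF; rewrite /ia /ib /oa /ob.
    by move=> ap bp; rewrite fa ?flip_notin.
  by move=> ap bp; rewrite fb ?flip_notin.
- move=> A /subsetP AX h; apply/subset_leq_card/subsetP => p pA.
  by rewrite inE AX //; apply: h.
- move=> A /subsetP AX h.
  apply: (@leq_trans #|[set p in only x y | (a \in p) || (b \in p)]|).
    by apply/subset_leq_card/subsetP => p pA; rewrite inE AX // h.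
  rewrite (card_split a) (card_split b [set p in [set p in only x y | (a \in p) || (b \in p)] | a \in p]).
  apply/eq_leq; congr (_ + _ + _); apply: eq_card => p; rewrite !inE /ia /ib /oa /ob.
  + by case: (a \in p); rewrite ?andbF ?andbT.
  + by case: (a \in p); rewrite ?andbF ?andbT.
  + by case: (a \in p); case: (b \in p); rewrite ?andbF ?andbT.
Qed.

Lemma quarter_bound n1 n2 n3 n4 m1 m2 m3 m4 :
    n1 <= n2 -> n1 <= n3 -> n2 <= n4 -> n3 <= n4 ->
    m1 <= m2 -> m1 <= m3 -> m2 <= m4 -> m3 <= m4 ->
  n1 + (m1 + m2 + m3) <= maxn (n1 + n2 + n3 + n4) (m1 + m2 + m3 + m4).
Proof. lia_goal. Qed.

(** If [c] is also common to [B], both classes fill at most half of their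
surroundings.  Otherwise a member of [B] avoiding [c] forces a second common
vertex [e] upon [A]; then [A] fills at most a quarter, and [B], whose members
must all meet [ce], at most three quarters. *)
Lemma crossing_common_card x y A B c p0 : x != y -> adj x y ->
    crossing x y A B -> p0 \in A -> c \in link x y -> {in A, forall p, c \in p} ->
  #|A| + #|B| <= maxn #|only x y| #|only y x|.
Proof.
move=> nxy xy cr p0A cL cA; have [hA hB _] := cr.
have AX : A \subset only x y.
  by apply/subsetP => p /hA[pF xp yp]; rewrite inE pF xp.
have BX : B \subset only y x.
  by apply/subsetP => p /hB[pF xp yp]; rewrite inE pF xp.
have [/forall_inP cB|] := boolP [forall q in B, c \in q].
  have := only_half cL AX cA; rewrite linkC in cL.
  have := only_half cL BX cB; lia_goal.
rewrite negb_forall => /existsP[q]; rewrite negb_imply => /andP[qB cq].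
have [e [eq eL ecy eA]] := crossing_share nxy xy cr p0A cL cA qB cq.
have [p0F xp0 yp0] := hA _ p0A; have cp0 := cA _ p0A; have ep0 := eA _ p0A.
have nce : c != e by neq_tac.
have ce : adj c e by adj_tac.
have [v [vp0 vL tr]] := trace_le2 p0F nxy xy cp0 cL.
have hB' : {in B, forall q, (c \in q) || (e \in q)}.
  move=> q' q'B; have [f [fp0 fq' fL]] := crossing_meet cr p0A q'B.
  have [ev|ev] := tr _ ep0 eL; first by rewrite ev eqxx in nce.
  by have [E|E] := tr _ fp0 fL; rewrite ?ev -E fq' ?orbT.
have [n1 [n2 [n3 [n4 [-> [? ?] [? ?] bA _]]]]] := only_patterns cL eL ce nce.
have {}bA := bA _ AX; rewrite linkC in cL eL.
have [m1 [m2 [m3 [m4 [-> [? ?] [? ?] _ bB]]]]] := only_patterns cL eL ce nce.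
have {}bB := bB _ BX hB'.
have {}bA : #|A| <= n1 by apply: bA => p pA; rewrite cA ?eA.
apply: (leq_trans (leq_add bA bB)).
exact: quarter_bound.
Qed.

(** A member with trace [u1 v1] is flipped at [u1], one with trace [u2 v2] at [v2].
The results contain [v1] without [u1], respectively [u2] without [v2], so they
are outside [A], and they do not collide as [v1] and [u2] are not adjacent. *)
Lemma four_cycle_half x y A B p0 q0 : x != y -> adj x y -> crossing x y A B ->
    p0 \in A -> q0 \in B ->
    {in link x y, forall c, exists2 p, p \in A & c \notin p} ->
    {in link x y, forall c, exists2 q, q \in B & c \notin q} ->
  #|A|.*2 <= #|only x y|.
Proof.
move=> nxy xy cr p0A q0B ncA ncB; have [hA hB _] := cr.
have [u1 [v1 [u2 [v2 [[u1L v1L u2L v2L]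
   [[nuv1 nuv2 uv1 uv2] [nu1v2 nv1u2 hA']]]]]]] := four_cycle nxy xy cr p0A q0B ncA ncB.
have AX p : p \in A -> p \in only x y.
  by move=> /hA[pF xp yp]; rewrite inE pF xp.
rewrite (card_split u1 A).
set A1 := [set p in A | u1 \in p]; set A2 := [set p in A | u1 \notin p].
pose B1 := [set p in only x y | (v1 \in p) && (u1 \notin p)].
pose B2 := [set p in only x y | (u2 \in p) && (v2 \notin p)].
have le1 : #|A1| <= #|B1|.
  apply: (@flip_count u1) => p; rewrite inE => /andP[pA u1p].
  case: (hA' p pA) => -[]; rewrite ?u1p // => _ v1p u2p v2p.
  have pX := AX _ pA; have pF := only_facet pX; split=> //.
  rewrite inE (only_flip u1L pX u1p).
  by rewrite flip_notin // flip_mem ?v1p // eq_sym.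
have le2 : #|A2| <= #|B2|.
  apply: (@flip_count v2) => p; rewrite inE => /andP[pA u1p].
  case: (hA' p pA) => -[]; rewrite ?(negPf u1p) // => _ v1p u2p v2p.
  have pX := AX _ pA; have pF := only_facet pX; split=> //.
  rewrite inE (only_flip v2L pX v2p).
  by rewrite flip_notin // flip_mem ?u2p // adjC.
have sub : #|A1 :|: A2 :|: (B1 :|: B2)| <= #|only x y|.
  apply/subset_leq_card/subsetP => p; rewrite 3!in_setU.
  by case/orP => /orP[]; rewrite inE => /andP[] // /AX.
have d12 : A1 :&: A2 = set0.
  by apply/setP => p; rewrite !inE; case: (u1 \in p); rewrite ?andbF.
have d34 : B1 :&: B2 = set0.
  apply/setP => p; rewrite !inE; apply/negP.
  case/andP => /and3P[/and3P[pF _ _] v1p _] /and3P[_ u2p _].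
  have pC : p \in facets C by rewrite inE.
  by move/negP: nv1u2; apply; adj_tac.
have dd : (A1 :|: A2) :&: (B1 :|: B2) = set0.
  apply/setP => p; rewrite !inE -andb_orr; apply/negP => /andP[].
  case/andP => /hA'[] [h1 h2 h3 h4] _.
    by rewrite h1 h2 (negPf h3) /= ?andbF.
  by rewrite (negPf h2) h4 /= ?andbF.
move: le1 le2 sub; rewrite !cardsU d12 d34 dd !cards0; lia_goal.
Qed.

Lemma crossing_card x y A B : x != y -> adj x y -> crossing x y A B ->
  #|A| + #|B| <= maxn #|only x y| #|only y x|.
Proof.
move=> nxy xy cr; have [hA hB _] := cr.
have AX : #|A| <= #|only x y|.
  by apply/subset_leq_card/subsetP => p /hA[pF xp yp]; rewrite inE pF xp.
have BX : #|B| <= #|only y x|.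
  by apply/subset_leq_card/subsetP => p /hB[pF xp yp]; rewrite inE pF xp.
have [A0|/set0Pn[p0 p0A]] := eqVneq A set0; first by move: BX; rewrite A0 cards0; lia_goal.
have [B0|/set0Pn[q0 q0B]] := eqVneq B set0; first by move: AX; rewrite B0 cards0; lia_goal.
have cr' := crossingC cr; have yx : adj y x by adj_tac.
have nyx : y != x by neq_tac.
have dich (D : {set {set T}}) : (exists2 c, c \in link x y & {in D, forall p, c \in p}) \/
    {in link x y, forall c, exists2 p, p \in D & c \notin p}.
  have [/exists_inP[c cL /forall_inP]|none] :=
    boolP [exists c in link x y, [forall p in D, c \in p]].
    by left; exists c.
  right=> c cL; move: none; rewrite negb_exists_in => /forall_inP/(_ _ cL).
  by rewrite negb_forall => /existsP[p]; rewrite negb_imply => /andP[]; exists p.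
have [[c cL cA]|ncA] := dich A; first exact: (crossing_common_card nxy xy cr p0A cL cA).
have [[c cL cB]|ncB] := dich B.
  rewrite addnC maxnC; rewrite linkC in cL.
  exact: (crossing_common_card nyx yx cr' q0B cL cB).
have := four_cycle_half nxy xy cr p0A q0B ncA ncB.
have := four_cycle_half nyx yx cr' q0B p0A; rewrite linkC => /(_ ncB ncA).
lia_goal.
Qed.

(** The members through both [x] and [y] count for either star, and
[crossing_card] bounds the others. *)
Lemma two_stars (F : {set {set T}}) x y : F \subset facets C -> intersecting F -> adj x y ->
  {in F, forall p, (x \in p) || (y \in p)} ->
  #|F| <= #|facets_at C x| \/ #|F| <= #|facets_at C y|.
Proof.
move=> /subsetP FF Fint xy hit.
have [E|nxy] := eqVneq x y.
  left; apply/subset_leq_card/subsetP => p pF; rewrite inE FF //.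
  by case/orP: (hit _ pF) => //; rewrite E.
pose A := [set p in F | (x \in p) && (y \notin p)].
pose B := [set p in F | (y \in p) && (x \notin p)].
pose D := [set p in facets C | (x \in p) && (y \in p)].
have cr : crossing x y A B.
  split=> [p|q|p q]; [by rewrite inE => /and3P[/FF] ..|].
  rewrite !inE => /and3P[pF xp yp] /and3P[qF yq xq].
  have npq : p != q by apply: contraNneq yp => ->.
  have := Fint _ _ pF qF npq; rewrite -setI_eq0 => /set0Pn[e].
  by rewrite inE => /andP[ep eq]; exists e.
have := crossing_card nxy xy cr.
have starE a b : #|facets_at C a| = #|[set p in facets C | (a \in p) && (b \in p)]| + #|only a b|.
  rewrite (card_split b); congr (_ + _); apply: eq_card => p; rewrite !inE;
  by rewrite -!andbA.
have Dsym : [set p in facets C | (y \in p) && (x \in p)] = D.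
  by apply/setP => p; rewrite !inE; congr (_ && _); apply: andbC.
rewrite (starE x y) (starE y x) Dsym -/D.
have : #|F| <= #|D| + #|A| + #|B|.
  have FU : F \subset D :|: A :|: B.
    apply/subsetP => p pF; have := FF _ pF; rewrite !inE pF => -> /=.
    by move: (hit _ pF); case: (x \in p); case: (y \in p).
  by move: (subset_leq_card FU); rewrite !cardsU; lia_goal.
lia_goal.
Qed.

Lemma facet_quad p q x y z u : p \in facets C -> q \in facets C ->
  uniq [:: x; y; z; u] ->
  x \in p -> y \in p -> z \in p -> u \in p ->
  x \in q -> y \in q -> z \in q -> u \in q -> p = q.
Proof.
move=> pF qF Us *.
have eq_quad r : r \in facets C -> x \in r -> y \in r -> z \in r -> u \in r ->
    [set v in [:: x; y; z; u]] = r.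
  move=> rF *; apply/eqP; rewrite eqEcard; apply/andP; split.
    by apply/subsetP => v; rewrite !inE => /or4P[] /eqP->.
  by rewrite cardsE (card_uniqP Us) face_card // facet_face.
by rewrite -(eq_quad p) // (eq_quad q).
Qed.

(** * A maximum family larger than all stars *)

Section MaxFamily.

Variable F : {set {set T}}.
Hypotheses (FF : {subset F <= facets C}) (Fint : intersecting F).
Hypothesis Fmax : forall F' : {set {set T}},
  F' \subset facets C -> intersecting F' -> #|F'| <= #|F|.
Hypothesis Fbig : forall v, #|facets_at C v| < #|F|.

Lemma F_meet p q : p \in F -> q \in F -> exists2 e, e \in p & e \in q.
Proof.
move=> pF qF; have [<-|npq] := eqVneq p q.
  by have [e ep] := facet_neq0 (FF pF); exists e.
have := Fint pF qF npq; rewrite -setI_eq0 => /set0Pn[e].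
by rewrite inE => /andP[ep eq]; exists e.
Qed.

Lemma F_maximal p : p \in facets C ->
  {in F, forall q, exists2 e, e \in p & e \in q} -> p \in F.
Proof.
move=> pC meet; have [//|pF] := boolP (p \in F).
suff: #|p |: F| <= #|F| by rewrite cardsU1 pF ltnn.
apply: Fmax; first by rewrite subUset sub1set pC; apply/subsetP.
have dj q r e : e \in q -> e \in r -> ~~ [disjoint q & r :> {set T}].
  by move=> eq er; rewrite -setI_eq0; apply/set0Pn; exists e; rewrite inE eq.
move=> q r; rewrite !inE => /predU1P[->|qF] /predU1P[->|rF] nqr.
- by rewrite eqxx in nqr.
- by have [e ep er] := meet _ rF; apply: dj er.
- by have [e ep er] := meet _ qF; apply: dj ep.
exact: Fint.
Qed.

Lemma no_cover2 x y : adj x y -> exists p, [/\ p \in F, x \notin p & y \notin p].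
Proof.
move=> xy; have [/existsP[p /and3P[]]|none] :=
  boolP [exists p, [&& p \in F, x \notin p & y \notin p]]; first by exists p.
have FsC : F \subset facets C by apply/subsetP.
have hit : {in F, forall p, (x \in p) || (y \in p)}.
  move=> p pF; apply/negP => /negP; rewrite negb_or => nxy.
  by move/negP: none; apply; apply/existsP; exists p; rewrite pF.
by case: (two_stars FsC Fint xy hit); rewrite leqNgt Fbig.
Qed.

(** The traded family is intersecting and all its members meet [xy], so by
[two_stars] it is not larger than a star. *)
Lemma switch_edge x y : adj x y ->
  #|[set p in facets C | [&& x \in p, y \in p & p \notin F]]| <
  #|[set p in F | (x \notin p) && (y \notin p)]|.
Proof.
move=> xy; set N := [set p in facets C | _]; set R := [set p in F | _].
pose F' := (F :\: R) :|: N.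
have F'P p : p \in F' -> p \in facets C /\
    ((p \in F /\ ((x \in p) || (y \in p))) \/ (x \in p /\ y \in p)).
  case/setUP => [/setDP[pF pR]|]; last by rewrite inE => /and4P[? ? ? ?]; split; auto.
  split; first exact: FF.
  by left; split=> //; move: pR; rewrite inE pF /= negb_and !negbK.
have F'sC : F' \subset facets C by apply/subsetP => p /F'P[].
have dj e q r : e \in q -> e \in r -> ~~ [disjoint q & r :> {set T}].
  by move=> eq er; rewrite -setI_eq0; apply/set0Pn; exists e; rewrite inE eq.
have F'int : intersecting F'.
  move=> p q /F'P[_ [[pF /orP[hp|hp]]|[xp yp]]] /F'P[_ [[qF /orP[hq|hq]]|[xq yq]]] npq;
  first [by apply: Fint | by apply: (dj x) | by apply: (dj y)].
have F'hit : {in F', forall p, (x \in p) || (y \in p)}.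
  by move=> p /F'P[_ [[_ //]|[-> _]]].
have : #|F'| < #|F|.
  by case: (two_stars F'sC F'int xy F'hit) => /leq_ltn_trans; apply.
have dis : (F :\: R) :&: N = set0.
  by apply/setP => p; rewrite !inE; case: (p \in F); rewrite ?andbF.
have RF : R \subset F by apply/subsetP => p; rewrite inE => /andP[].
rewrite /F' cardsU dis cards0 cardsD (setIidPr RF).
have := subset_leq_card RF; lia.
Qed.

Definition cover3 x y z := [forall p in F, [|| x \in p, y \in p | z \in p]].

Lemma cover3P x y z p : cover3 x y z -> p \in F ->
  x \notin p -> y \notin p -> z \in p.
Proof.
by move/forall_inP => h /h/or3P[] // ->.
Qed.

Lemma cover3_perm x y z : (cover3 x y z = cover3 y x z) * (cover3 x y z = cover3 x z y).
Proof.
split; apply: eq_forallb => p; congr (_ ==> _).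
  exact: orbCA.
by congr (_ || _); apply: orbC.
Qed.

Lemma cover3_facet x y z p : cover3 x y z -> p \in facets C ->
  x \in p -> y \in p -> z \in p -> p \in F.
Proof.
move=> /forall_inP cov pC xp yp zp; apply: F_maximal => // q /cov/or3P[]; 
 [exists x | exists y | exists z] => //.
Qed.

(** A member [r] missing the triangle would meet [p] and [q] in their respective
fourth vertices, making these adjacent. *)
Lemma share3 x y z p q : p \in F -> q \in F -> p != q ->
  x != y -> x != z -> y != z -> x \in p -> y \in p -> z \in p ->
  x \in q -> y \in q -> z \in q -> cover3 x y z.
Proof.
move=> pF qF npq nxy nxz nyz xp yp zp xq yq zq.
apply/forall_inP => r rF; apply/negP => /negP; rewrite !negb_or.
case/and3P => xr yr zr.
have [u up ur] := F_meet pF rF; have [v vq vr] := F_meet qF rF.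
have [E|nuv] := eqVneq u v.
  move/eqP: npq; apply; apply: (@facet_quad _ _ x y z u); rewrite ?FF //; last by rewrite E.
  by rewrite /= !inE !negb_or nxy nxz nyz /=; rewrite andbT; do ![apply/andP; split]; neq_tac.
by clique5_tac x y z u v.
Qed.

Definition deg3 x y z :=
  #|[set p in facets C | [&& x \in p, y \in p & z \in p]]|.

Lemma deg3_perm x y z : (deg3 x y z = deg3 y x z) * (deg3 x y z = deg3 x z y).
Proof.
split; apply: eq_card => p; rewrite !inE; congr (_ && _); first exact: andbCA.
by congr (_ && _); apply: andbC.
Qed.

Definition triangle x y z := [/\ x != y, x != z & y != z] /\ [/\ adj x y, adj x z & adj y z].

Lemma triangle_perm x y z : triangle x y z -> triangle y x z /\ triangle x z y.
Proof.
by case=> -[? ? ?] [? ? ?]; split; split; split=> //; rewrite 1?eq_sym 1?adjC.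
Qed.

Lemma triangle_facet x y z : triangle x y z ->
  exists p, [/\ p \in facets C, x \in p, y \in p & z \in p].
Proof.
case=> _ [xy xz yz].
have : [set v in [:: x; y; z]] \in C by apply: pairwise_face; rewrite //= xy xz yz.
case/face_in_facet => p pF /subsetP sp; exists p.
by split=> //; apply: sp; rewrite !inE eqxx ?orbT.
Qed.

Lemma quad_facet x y z u : triangle x y z -> adj x u -> adj y u -> adj z u ->
  exists p, [/\ p \in facets C, x \in p, y \in p & z \in p /\ u \in p].
Proof.
case=> _ [xy xz yz] xu yu zu.
have : [set v in [:: x; y; z; u]] \in C.
  by apply: pairwise_face; rewrite //= xy xz yz xu yu zu.
case/face_in_facet => p pF /subsetP sp; exists p.
by do !split=> //; apply: sp; rewrite !inE eqxx ?orbT.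
Qed.

Lemma deg3_gt0 x y z : triangle x y z -> 0 < deg3 x y z.
Proof.
move=> /triangle_facet[p [pF xp yp zp]]; apply/card_gt0P; exists p.
by rewrite inE pF xp yp zp.
Qed.

Lemma deg3_gt1 x y z p : triangle x y z -> p \in facets C -> #|p| = 4 ->
  1 < deg3 x y z.
Proof.
move=> t pF p4; have [q [qF xq yq zq]] := triangle_facet t; have [[nxy nxz nyz] _] := t.
have q4 : #|q| = 4 by rewrite (Cpure qF pF).
have [w wq wn] : exists2 w, w \in q & w \notin [set x; y; z].
  apply/subsetPn/negP => /subset_leq_card; rewrite q4.
  by rewrite -setUA cardsU1 cards2; case: (_ \notin _); case: (_ != _).
move: wn; rewrite !inE !negb_or -andbA => /and3P[nwx nwy nwz].
apply/card_gt1P; exists q, (flip w q); split; first by rewrite inE qF xq yq zq.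
  rewrite inE flip_facet // !flip_mem ?xq ?yq ?zq //; by [adj_tac | neq_tac].
by apply: contraNneq (flip_notin qF wq) => <-.
Qed.

(** * When a triangle meets all members *)

Definition heavy x y z := [/\ triangle x y z, cover3 x y z &
  forall x' y' z', triangle x' y' z' -> cover3 x' y' z' -> deg3 x' y' z' <= deg3 x y z].

Lemma heavy_swap12 x y z : heavy x y z -> heavy y x z.
Proof.
move=> [/triangle_perm[t _] cv h]; split=> //; first by rewrite (cover3_perm y x z).1.
by move=> *; rewrite (deg3_perm y x z).1; apply: h.
Qed.

Lemma heavy_swap23 x y z : heavy x y z -> heavy x z y.
Proof.
move=> [/triangle_perm[_ t] cv h]; split=> //; first by rewrite (cover3_perm x z y).2.
by move=> *; rewrite (deg3_perm x z y).2; apply: h.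
Qed.

(** Classes of members by their trace on the triangle [xyz], called trace [x] and
trace [xy] below; the trace is never empty when the triangle meets all
members. *)
Definition trace1 x y z := [set p in F | [&& x \in p, y \notin p & z \notin p]].
Definition trace2 x y z := [set p in F | [&& x \in p, y \in p & z \notin p]].

Lemma trace1P x y z p : p \in trace1 x y z -> [/\ p \in F, p \in facets C, x \in p, y \notin p & z \notin p].
Proof. by rewrite inE => /and4P[pF ? ? ?]; split=> //; apply: FF. Qed.

Lemma trace2P x y z p : p \in trace2 x y z -> [/\ p \in F, p \in facets C, x \in p, y \in p & z \notin p].
Proof. by rewrite inE => /and4P[pF ? ? ?]; split=> //; apply: FF. Qed.

Lemma mem_trace1 x y z p : p \in F -> x \in p -> y \notin p -> z \notin p -> p \in trace1 x y z.
Proof. by rewrite inE => -> -> -> ->. Qed.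

Lemma mem_trace2 x y z p : p \in F -> x \in p -> y \in p -> z \notin p -> p \in trace2 x y z.
Proof. by rewrite inE => -> -> -> ->. Qed.

Lemma trace1C x y z : trace1 x y z = trace1 x z y.
Proof. by apply/setP => p; rewrite !inE; do 2 congr (_ && _); apply: andbC. Qed.

(** Members missing [x] and [y] contain [z], and they outnumber what would be
gained by trading them for the star of [xy]. *)
Lemma heavy_switch x y z : heavy x y z ->
  #|[set p in facets C | [&& x \in p, y \in p & p \notin F]]| < #|trace1 z x y|.
Proof.
move=> [[_ [xy _ _]] cv _]; apply: leq_trans (switch_edge xy) _.
apply/subset_leq_card/subsetP => p; rewrite inE => /and3P[pF xp yp].
by apply: mem_trace1 => //; apply: cover3P cv pF xp yp.
Qed.

(** Flipping [z] turns facets through [xyz] into facets through [xy] without [z];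
those outside [F] are bounded by [heavy_switch]. *)
Lemma heavy_lt x y z : heavy x y z -> deg3 x y z < #|trace2 x y z| + #|trace1 z x y|.
Proof.
move=> t; have := heavy_switch t; set N := [set p in _ | _]; move=> lt.
have [[[nxy nxz nyz] [xy xz yz]] cv _] := t.
suff : deg3 x y z <= #|trace2 x y z :|: N|.
  by rewrite cardsU; lia.
apply: (@flip_count z) => p; rewrite inE => /and4P[pF xp yp zp].
have qF := flip_facet pF zp; have zq := flip_notin pF zp.
have xq : x \in flip z p by rewrite flip_mem //; adj_tac.
have yq : y \in flip z p by rewrite flip_mem //; adj_tac.
split=> //; apply/setUP; have [qf|qf] := boolP (flip z p \in F).
  by left; rewrite inE qf xq yq zq.
by right; rewrite inE qF xq yq qf.
Qed.

(** All members of trace [z] meet a member of trace [xy] in the link of the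
triangle, hence in one vertex [a].  Then [xya] also meets all members, and as
[xyz] is heaviest, members of trace [xy] are fewer than the facets through
[xyz]: the facet [xyza] does not count. *)
Lemma heavy_trace2 x y z p : heavy x y z -> p \in trace2 x y z ->
  exists a, [/\ a \in link x y, a \in link y z, cover3 x y a,
                {in trace1 z x y, forall q, a \in q} &
                {in trace2 x y z, forall q, a \in q}]
            /\ #|trace2 x y z| < deg3 x y z.
Proof.
move=> t pf; have [[[nxy nxz nyz] [xy xz yz]] cv tmax] := t.
have [q0 q0f] : exists q0, q0 \in trace1 z x y.
  by apply/card_gt0P; apply: leq_ltn_trans (heavy_switch t).
have [q0F q0C zq0 xq0 yq0] := trace1P q0f.
have common r : r \in trace2 x y z -> exists a, [/\ a \in r, a \in link x y, a \in link y z &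
    {in trace1 z x y, forall q, a \in q}].
  move=> /trace2P[rF rC xr yr zr].
  apply: (common_meet rC nxy nxz nyz xy xz yz q0f) => q /trace1P[qF qC zq xq yq].
  have [e er eq] := F_meet rF qF.
  by exists e; split=> //; apply/linkP; split; try adj_tac; neq_tac.
have [a [ap aL aL' aA]] := common _ pf.
have [pF pC xp yp zp] := trace2P pf.
have /linkP[xa ya nax nay] := aL; have /linkP[_ za _ naz] := aL'.
have aB : {in trace2 x y z, forall q, a \in q}.
  move=> r rf; have [b [br /linkP[xb yb nbx nby] /linkP[_ zb _ nbz] bA]] := common _ rf.
  have [-> //|nab] := eqVneq a b.
  have aq0 := aA _ q0f; have bq0 := bA _ q0f.
  by clique5_tac x y z a b.
have [t3 _ _] := t.
have [s [sC xs ys [zs sa]]] := quad_facet t3 xa ya za.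
have sF : s \in F by apply: cover3_facet cv _ _ _ _.
have cva : cover3 x y a.
  have nps : p != s by apply: contraNneq zp => ->.
  by apply: (share3 pF sF) => //; try neq_tac; apply: aB.
exists a; split; first by split.
have ta : triangle x y a by do !split=> //; rewrite eq_sym.
apply: leq_trans (tmax _ _ _ ta cva).
apply/proper_card/properP; split.
  by apply/subsetP => r rf; have [rF rC xr yr zr] := trace2P rf; rewrite inE rC xr yr aB.
by exists s; rewrite inE ?sC ?xs ?ys ?sa // zs !andbF.
Qed.

Lemma heavy_trace1_gt1 x y z : heavy x y z -> 1 < #|trace1 z x y|.
Proof.
move=> t; have [t3 _ _] := t; have := heavy_lt t; have := deg3_gt0 t3.
have [f0|/set0Pn[p pf]] := eqVneq (trace2 x y z) set0; first by rewrite f0 cards0; lia.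
have [a [_ lt]] := heavy_trace2 t pf; lia.
Qed.

(** Members of trace [z] contain [a], and meet [q0], which misses the edge [za],
in one vertex [q].  So [zaq] meets all members too, and this determines much of
the members of trace [y]. *)
Lemma heavy_missing_edge x y z a q0 : heavy x y z -> cover3 x y a ->
    a \in link x y -> a \in link y z -> {in trace1 z x y, forall p, a \in p} ->
    q0 \in F -> z \notin q0 -> a \notin q0 -> x \in q0 -> y \notin q0 ->
  exists q : T, [/\ [/\ adj q x, adj q z & adj q a],
             ~~ adj q y, x != q, cover3 z a q &
             {in trace1 y x z, forall p, a \in p} /\
             exists p, [/\ p \in trace2 x z y, q \in p & a \in p]].
Proof.
move=> t cva /linkP[xa ya nax nay] /linkP[_ za _ naz] aA q0F zq0 aq0 xq0 yq0.
have [[[nxy nxz nyz] [xy xz yz]] cv tmax] := t; have q0C := FF q0F.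
have [p1 [p2 [p1f p2f np12]]] := card_gt1P (heavy_trace1_gt1 t).
have nxa : x != a by neq_tac.
have nza : z != a by neq_tac.
have [q [qq0 /linkP[xq zq nqx nqz] /linkP[_ aq _ nqa] qA]] : exists q : T, [/\ q \in q0,
    q \in link x z, q \in link z a & {in trace1 z x y, forall p, q \in p}].
  apply: (common_meet q0C nxz nxa nza xz xa za p1f) => p pf.
  have [pF pC zp xp yp] := trace1P pf; have ap := aA _ pf.
  have [e eq0 ep] := F_meet q0F pF.
  by exists e; split=> //; apply/linkP; split; try adj_tac; neq_tac.
have [p1F p1C zp1 xp1 yp1] := trace1P p1f; have [p2F p2C zp2 xp2 yp2] := trace1P p2f.
have ap1 := aA _ p1f; have ap2 := aA _ p2f.
have qp1 := qA _ p1f; have qp2 := qA _ p2f.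
have cvq : cover3 z a q by apply: (share3 p1F p2F) => //; neq_tac.
have nqy : ~~ adj q y.
  apply/negP => yq; have nqy : q != y by neq_tac.
  by clique5_tac x y z a q.
have aB : {in trace1 y x z, forall p, a \in p}.
  move=> p /trace1P[pF pC yp xp zp]; have [//|ap] := boolP (a \in p).
  by case/negP: nqy; have := cover3P cvq pF zp ap => qp; adj_tac.
have txza : triangle x z a by do !split.
have [p [pC xp zp [ap qp]]] := quad_facet txza xq zq aq.
have pF : p \in F by apply: cover3_facet cvq _ _ _ _.
exists q; split=> //; try neq_tac; first by split; adj_tac.
split=> //; exists p; split=> //; apply: mem_trace2 => //.
by apply: contra nqy => yp; adj_tac.
Qed.

(** The analysis of a member missing [za] produces one missing [ya], then
one missing [xa].  Together they fix all vertices of the members of trace [x],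
of which there are at least two. *)
Lemma heavy_trace2_absurd x y z a q0 : heavy x y z -> cover3 x y a ->
    a \in link x y -> a \in link y z -> {in trace1 z x y, forall p, a \in p} ->
    q0 \in F -> z \notin q0 -> a \notin q0 -> x \in q0 -> y \notin q0 -> False.
Proof.
move=> t cva aL aL' aA q0F zq0 aq0 xq0 yq0.
have /linkP[xa ya nax nay] := aL; have /linkP[_ za _ naz] := aL'.
have [q [[qx qz qa] qy nxq cvq [aB [p [pf qp ap]]]]] :=
  heavy_missing_edge t cva aL aL' aA q0F zq0 aq0 xq0 yq0.
have [[[nxy nxz nyz] [xy xz yz]] cv tmax] := t; have t' := heavy_swap23 t.
have [a' [[/linkP[xa' za' na'x na'z] /linkP[_ ya' _ na'y] cva' _ aD] _]] := heavy_trace2 t' pf.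
have [pF pC xp zp yp] := trace2P pf; have a'p := aD _ pf.
(* [a] and [a'] both lie in [p] and in the link of [xyz] *)
have Ea : a = a' by apply/eqP/negP => /negP naa'; clique5_tac x y z a a'.
subst a'.
have [q1 [q1F yq1 aq1]] := no_cover2 ya.
have [xq1 zq1] : x \in q1 /\ z \notin q1.
  have [xq1|xq1] := boolP (x \in q1); split=> //.
    by apply: contra aq1 => zq1; apply: aD; apply: mem_trace2.
  case/negP: aq1; apply: aA; apply: mem_trace1 => //; exact: cover3P cv _ _ _.
  case/negP: aq1; apply: aA; apply: mem_trace1 => //; exact: cover3P cv _ _ _.
have [r [[rx ry ra] rz nxr cvr _]] :
  exists q : T, [/\ [/\ adj q x, adj q y & adj q a], ~~ adj q z, x != q, cover3 y a q &
   {in trace1 z x y, forall p, a \in p} /\ exists p, [/\ p \in trace2 x y z, q \in p & a \in p]].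
  apply: (heavy_missing_edge t' cva' _ _ _ q1F) => //.
    by apply/linkP.
  by apply/linkP.
have [q2 [q2F xq2 aq2]] := no_cover2 xa.
have yq2 : y \in q2.
  apply/negP => /negP yq2; case/negP: aq2; apply: aA.
  apply: mem_trace1 => //; exact: cover3P cv _ _ _.
have zq2 : z \in q2.
  by apply/negP => /negP zq2; case/negP: aq2; apply: aB; apply: mem_trace1.
have t'' := heavy_swap23 (heavy_swap12 t).
have q2f : q2 \in trace2 y z x by apply: mem_trace2.
have [c [[/linkP[yc zc ncy ncz] /linkP[_ xc _ ncx] _ cA cD] _]] := heavy_trace2 t'' q2f.
have cq2 := cD _ q2f.
have nac : ~~ adj a c by apply/negP => ac; clique5_tac x y z a c.
have [p1 [p2 [p1f p2f /eqP[]]]] := card_gt1P (heavy_trace1_gt1 t'').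
have Ux : uniq [:: x; c; q; r].
  rewrite /= !inE !negb_or andbT.
  by do ![apply/andP; split]; neq_tac.
have facts s : s \in trace1 x y z -> [/\ s \in facets C, x \in s, c \in s & q \in s /\ r \in s].
  move=> sf; have [sF sC xs ys zs] := trace1P sf; have cs := cA _ sf.
  have as' : a \notin s by apply: contra nac => as'; adj_tac.
  by do !split=> //; [apply: cover3P cvq _ _ _ | apply: cover3P cvr _ _ _].
have [? ? ? [? ?]] := facts _ p1f; have [? ? ? [? ?]] := facts _ p2f.
exact: facet_quad Ux _ _ _ _ _ _ _ _.
Qed.

Lemma heavy_trace2_eq0 x y z : heavy x y z -> trace2 x y z = set0.
Proof.
move=> t; apply/eqP/set0Pn => -[p pf].
have [a [[aL aL' cva aA aD] _]] := heavy_trace2 t pf.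
have [_ cv _] := t; have [_ za _ _] := linkP _ _ _ aL'.
have [q [qF zq aq]] := no_cover2 za.
have [xq|xq] := boolP (x \in q); have [yq|yq] := boolP (y \in q).
- by case/negP: aq; apply: aD; apply: mem_trace2.
- exact: (@heavy_trace2_absurd x y z a q).
- apply: (@heavy_trace2_absurd y x z a q (heavy_swap12 t)) => //.
  + by rewrite (cover3_perm y x a).1.
  + by rewrite linkC.
  + have [xa ? ? ?] := linkP _ _ _ aL; have [? ? ? ?] := linkP _ _ _ aL'.
    by have [[[? ? ?] [? ? ?]] _ _] := t; apply/linkP; split.
  by move=> r; rewrite trace1C; apply: aA.
by have := cover3P cv qF xq yq; rewrite (negPf zq).
Qed.

Lemma heavy_trace1_big x y z : heavy x y z -> deg3 x y z < #|trace1 x y z|.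
Proof.
move=> t; have t' := heavy_swap23 (heavy_swap12 t).
by have := heavy_lt t'; rewrite heavy_trace2_eq0 // cards0 add0n (deg3_perm y z x).2 (deg3_perm y x z).1.
Qed.

Lemma heavy_crossing x y z : crossing x y (trace1 x y z) (trace1 y x z).
Proof.
split=> [p /trace1P[? ? ? ? ?]|p /trace1P[? ? ? ? ?]|p q /trace1P[pF _ _ _ _] /trace1P[qF _ _ _ _]] //.
exact: F_meet.
Qed.

(** Otherwise the triangle [xce] would lie in at least two members, hence meet all
of them, and be heavier than [xyz]. *)
Lemma heavy_no_common_pair x y z c e : heavy x y z -> x != c -> x != e -> c != e ->
  {in trace1 x y z, forall p, c \in p} -> {in trace1 x y z, forall p, e \in p} -> False.
Proof.
move=> t nxc nxe nce cA eA; have := heavy_trace1_big t; apply/negP; rewrite -leqNgt.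
have [p1 [p2 [p1f p2f np12]]] := card_gt1P (heavy_trace1_gt1 (heavy_swap23 (heavy_swap12 t))).
have [_ _ tmax] := t.
have [p1F p1C xp1 yp1 zp1] := trace1P p1f; have [p2F p2C xp2 yp2 zp2] := trace1P p2f.
have cp1 := cA _ p1f; have ep1 := eA _ p1f.
have cv : cover3 x c e.
  by apply: (share3 p1F p2F) => //; [apply: cA | apply: eA].
have tc : triangle x c e by do !split=> //; adj_tac.
apply: leq_trans (tmax _ _ _ tc cv); apply/subset_leq_card/subsetP => p pf.
by have [pF pC xp yp zp] := trace1P pf; rewrite inE pC xp cA ?eA.
Qed.

(** Members of trace [x] meet those of trace [y] in the link of [xc], where [q0]
traces the edge [e0 v0].  If [q1] avoided [e0], it would trace a disjoint edge
there.  A member of trace [x] contains one end of each, and the link has no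
triangle, so there would be only two such members, against
[heavy_trace1_big]. *)
Lemma heavy_far_trace x y z c q0 q1 e0 v0 p1 p2 : heavy x y z ->
    {in trace1 x y z, forall p, c \in p} -> x != c -> ~~ adj c y ->
    q0 \in trace1 y x z -> e0 \in link x c -> v0 \in link x c -> e0 \in q0 -> v0 \in q0 ->
    {in trace1 x y z, forall p, (e0 \in p) || (v0 \in p)} ->
    p1 \in trace1 x y z -> p2 \in trace1 x y z -> e0 \notin p1 -> v0 \notin p2 ->
    q1 \in trace1 y x z -> e0 \in q1.
Proof.
move=> t cA nxc ncy q0f e0L v0L e0q0 v0q0 hit p1f p2f e0p1 v0p2 q1f.
have [q0F q0C yq0 xq0 zq0] := trace1P q0f; have [q1F q1C yq1 xq1 zq1] := trace1P q1f.
have [p1F p1C xp1 yp1 zp1] := trace1P p1f; have [p2F p2C xp2 yp2 zp2] := trace1P p2f.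
have v0p1 : v0 \in p1 by have := hit _ p1f; rewrite (negPf e0p1).
have e0p2 : e0 \in p2 by have := hit _ p2f; rewrite (negPf v0p2) orbF.
apply/negP => /negP e0q1.
have cp1 := cA _ p1f; have cp2 := cA _ p2f; have xc : adj x c by adj_tac.
have cq1 : c \notin q1 by apply: contra ncy => cq1; adj_tac.
have meet p : p \in trace1 x y z -> exists e, [/\ e \in p, e \in q1 & e \in link x c].
  move=> pf; have [pF pC xp yp zp] := trace1P pf; have cp := cA _ pf.
  have [e ep eq1] := F_meet pF q1F; exists e; split=> //.
  by apply/linkP; split; try adj_tac; neq_tac.
(* [p2] avoids [v0], so [q1] meets it in a vertex [e1] adjacent to [e0] *)
have trifree := link_triangle_free nxc xc.
have [e1 [e1p2 e1q1 e1L]] := meet _ p2f.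
have ne01 : e0 != e1 by neq_tac.
have ne0v0 : e0 != v0 by neq_tac.
have ne1v0 : e1 != v0 by neq_tac.
have e1v0 : ~~ adj e1 v0.
  apply/negP => a; move/eqP: ne1v0; apply; apply: (trifree e0) => //; adj_tac.
have [v1 [v1q1 v1L tr1]] := trace_le2 q1C nxc xc e1q1 e1L.
have hit1 p : p \in trace1 x y z -> e1 \in p \/ v1 \in p.
  by move=> /meet[e [ep eq1 eL]]; have [<-|<-] := tr1 _ eq1 eL; auto.
have [nv01|nv01] := eqVneq v0 v1.
  by rewrite -nv01 in v1q1; case/negP: e1v0; adj_tac.
have e1p1 : e1 \notin p1 by apply: contra e1v0 => ?; adj_tac.
have v1p1 : v1 \in p1 by have [] := hit1 _ p1f; rewrite ?(negPf e1p1).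
have e0v1 : ~~ adj e0 v1.
  by apply/negP => a; move/eqP: nv01; apply; apply: (trifree e0) => //; first [adj_tac | neq_tac].
have [t3 _ _] := t.
have /linkP[xe0 ce0 ne0x ne0c] := e0L; have /linkP[xe1 ce1 ne1x ne1c] := e1L.
have /linkP[xv0 cv0 nv0x nv0c] := v0L; have /linkP[xv1 cv1 nv1x nv1c] := v1L.
have Ue : uniq [:: x; c; e0; e1].
  by rewrite /= !inE !negb_or andbT; do ![apply/andP; split]; rewrite // eq_sym.
have Uv : uniq [:: x; c; v0; v1].
  by rewrite /= !inE !negb_or andbT; do ![apply/andP; split]; rewrite // eq_sym.
have p24 : #|p2| = 4.
  apply/eqP; rewrite eqn_leq face_card ?facet_face //=.
  have := card_uniqP Ue; rewrite /= => <-; apply/subset_leq_card/subsetP => w.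
  by rewrite !inE => /or4P[] /eqP->.
have := heavy_trace1_big t; have := deg3_gt1 t3 p2C p24.
suff : #|trace1 x y z| <= 2 by lia_goal.
apply: (@leq_trans #|[set p1; p2]|); last by rewrite cards2; case: (_ != _).
apply/subset_leq_card/subsetP => p pf; rewrite !inE; apply/orP.
have [pF pC xp yp zp] := trace1P pf; have cp := cA _ pf.
have [e0p|v0p] := orP (hit _ pf).
- right; apply/eqP; have [e1p|v1p] := hit1 _ pf.
    exact: facet_quad Ue _ _ _ _ _ _ _ _.
  by case/negP: e0v1; adj_tac.
left; apply/eqP; have [e1p|v1p] := hit1 _ pf; last exact: facet_quad Uv _ _ _ _ _ _ _ _.
by case/negP: e1v0; adj_tac.
Qed.

(** If [c] is not adjacent to [y], then by [heavy_far_trace] all members of trace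
[y] contain the same two further vertices. *)
Lemma heavy_common_adj x y z c : heavy x y z -> x != c ->
  {in trace1 x y z, forall p, c \in p} -> adj c y.
Proof.
move=> t nxc cA; have [//|ncy] := boolP (adj c y); exfalso.
have [p0 [_ [p0f _ _]]] := card_gt1P (heavy_trace1_gt1 (heavy_swap23 (heavy_swap12 t))).
have [q0 [_ [q0f _ _]]] := card_gt1P (heavy_trace1_gt1 (heavy_swap23 t)).
have [p0F p0C xp0 yp0 zp0] := trace1P p0f; have [q0F q0C yq0 xq0 zq0] := trace1P q0f.
have cp0 := cA _ p0f; have xc : adj x c by adj_tac.
have cq0 : c \notin q0 by apply: contra ncy => cq0; adj_tac.
have meet p : p \in trace1 x y z -> exists e, [/\ e \in p, e \in q0 & e \in link x c].
  move=> pf; have [pF pC xp yp zp] := trace1P pf; have cp := cA _ pf.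
  have [e ep eq0] := F_meet pF q0F; exists e; split=> //.
  by apply/linkP; split; try adj_tac; neq_tac.
have [e0 [e0p0 e0q0 e0L]] := meet _ p0f.
have [v0 [v0q0 v0L tr]] := trace_le2 q0C nxc xc e0q0 e0L.
have hit : {in trace1 x y z, forall p, (e0 \in p) || (v0 \in p)}.
  by move=> p /meet[e [ep eq0 eL]]; have [<-|<-] := tr _ eq0 eL; rewrite ep ?orbT.
have hit' : {in trace1 x y z, forall p, (v0 \in p) || (e0 \in p)}.
  by move=> p /hit; rewrite orbC.
have avoid e : e \in link x c -> exists2 p, p \in trace1 x y z & e \notin p.
  move=> /linkP[xe ce nex nec]; apply/exists_inP; rewrite -negb_forall_in.
  apply/negP => /forall_inP eA.
  by apply: (heavy_no_common_pair t nxc _ _ cA eA); rewrite eq_sym.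
have [p1 p1f e0p1] := avoid _ e0L; have [p2 p2f v0p2] := avoid _ v0L.
have [p2F p2C xp2 yp2 zp2] := trace1P p2f.
have e0p2 : e0 \in p2 by have := hit _ p2f; rewrite (negPf v0p2) orbF.
apply: (heavy_no_common_pair (c := e0) (e := v0) (heavy_swap12 t)); try neq_tac.
- have [p1F p1C xp1 yp1 zp1] := trace1P p1f.
  have v0p1 : v0 \in p1 by have := hit _ p1f; rewrite (negPf e0p1).
  by neq_tac.
- by move=> q1; apply: (heavy_far_trace t cA nxc ncy q0f e0L v0L e0q0 v0q0 hit p1f p2f).
by move=> q1; apply: (heavy_far_trace t cA nxc ncy q0f v0L e0L v0q0 e0q0 hit' p2f p1f).
Qed.

(** Such a vertex is adjacent to [y] and [z], hence spreads to the members of trace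
[y] and [z]; then the edge [xc] meets all members. *)
Lemma heavy_no_common x y z c : heavy x y z -> x != c ->
  {in trace1 x y z, forall p, c \in p} -> False.
Proof.
move=> t nxc cA; have cy := heavy_common_adj t nxc cA.
have t' := heavy_swap23 t.
have cA' : {in trace1 x z y, forall p, c \in p} by move=> p; rewrite trace1C; apply: cA.
have cz := heavy_common_adj t' nxc cA'.
have [p0 [_ [p0f _ _]]] := card_gt1P (heavy_trace1_gt1 (heavy_swap23 (heavy_swap12 t))).
have [p0F p0C xp0 yp0 zp0] := trace1P p0f; have cp0 := cA _ p0f.
have [[[nxy nxz nyz] [xy xz yz]] cv _] := t.
have xc : adj x c by adj_tac.
have spread y' z' : heavy x y' z' -> x != y' -> adj x y' -> adj c y' -> c != y' ->
    {in trace1 x y' z', forall p, c \in p} -> {in trace1 y' x z', forall p, c \in p}.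
  move=> s nxy' xy' cy' ncy' cAs q qf; have [//|cq] := boolP (c \in q).
  have [r [_ [rf _ _]]] := card_gt1P (heavy_trace1_gt1 (heavy_swap23 (heavy_swap12 s))).
  have cL : c \in link x y' by apply/linkP; split; rewrite // 1?eq_sym // adjC.
  have [e [eq /linkP[xe ye nex ney] /linkP[_ ce _ nec] eA]] :=
    crossing_share nxy' xy' (heavy_crossing x y' z') rf cL cAs qf cq.
  by case: (heavy_no_common_pair (c := c) (e := e) s); rewrite // eq_sym.
have ncy : c != y by neq_tac.
have ncz : c != z by neq_tac.
have cB := spread y z t nxy xy cy ncy cA.
have cD := spread z y t' nxz xz cz ncz cA'.
have [q [qF xq cq]] := no_cover2 xc.
have [yq|yq] := boolP (y \in q); have [zq|zq] := boolP (z \in q).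
- have : q \in trace2 y z x by apply: mem_trace2.
  by rewrite (heavy_trace2_eq0 (heavy_swap23 (heavy_swap12 t))) inE.
- by case/negP: cq; apply: cB; apply: mem_trace1.
- by case/negP: cq; apply: cD; apply: mem_trace1.
by have := cover3P cv qF xq yq; rewrite (negPf zq).
Qed.

(** A facet has only three vertices besides [x]. *)
Lemma quad_overlap p x u v (s t : T) : p \in facets C -> x \in p -> u \in p ->
  v \in p -> s \in p -> t \in p -> u != x -> v != x -> s != x -> t != x ->
  u != v -> s != t -> exists2 w, (w == u) || (w == v) & (w == s) || (w == t).
Proof.
move=> pC xp up vp sp tp nux nvx nsx ntx nuv nst.
have [us|nus] := eqVneq u s; first by exists u; rewrite ?us eqxx.
have [ut|nut] := eqVneq u t; first by exists u; rewrite ?ut eqxx ?orbT.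
have [vs|nvs] := eqVneq v s; first by exists v; rewrite ?vs eqxx ?orbT.
have [vt|nvt] := eqVneq v t; first by exists v; rewrite ?vt eqxx ?orbT.
by clique5_tac x u v s t.
Qed.

(** By [four_cycle] the members of trace [x] have two possible pairs of vertices in
the link of [xy], and two in the link of [xz].  The two pairs of one member
overlap, and the pairs in one link are disjoint, so the first pair determines
the second and with it the member.  This leaves two members, against
[heavy_trace1_big]. *)
Lemma no_heavy x y z : ~ heavy x y z.
Proof.
move=> t; have t' := heavy_swap23 t.
have [t3 cv _] := t; have [[nxy nxz nyz] [xy xz yz]] := t3.
have [p0 [_ [p0f _ _]]] := card_gt1P (heavy_trace1_gt1 (heavy_swap23 (heavy_swap12 t))).
have [q0 [_ [q0f _ _]]] := card_gt1P (heavy_trace1_gt1 t').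
have [r0 [_ [r0f _ _]]] := card_gt1P (heavy_trace1_gt1 t).
have avoid a b c e : heavy a b c -> a != e -> exists2 p, p \in trace1 a b c & e \notin p.
  move=> s nae; apply/exists_inP; rewrite -negb_forall_in.
  by apply/negP => /forall_inP; apply: heavy_no_common s nae.
have p0f' : p0 \in trace1 x z y by rewrite trace1C.
have r0f' : r0 \in trace1 z x y by [].
have avoidx w c : heavy x w c -> {in link x w, forall e, exists2 p, p \in trace1 x w c & e \notin p}.
  by move=> s e /linkP[_ _ nex _]; apply: avoid s _; rewrite eq_sym.
have avoidw w c : heavy x w c -> {in link x w, forall e, exists2 p, p \in trace1 w x c & e \notin p}.
  by move=> s e /linkP[_ _ _ new]; apply: avoid (heavy_swap12 s) _; rewrite eq_sym.
have [u1 [v1 [u2 [v2 [[u1L v1L u2L v2L]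
    [[nuv1 nuv2 uv1 uv2] [_ _ trY]]]]]]] :=
  four_cycle nxy xy (heavy_crossing x y z) p0f q0f (avoidx _ _ t) (avoidw _ _ t).
have [s1 [t1 [s2 [t2 [[s1L t1L s2L t2L]
    [[nst1 nst2 st1 st2] [_ _ trZ]]]]]]] :=
  four_cycle nxz xz (heavy_crossing x z y) p0f' r0f' (avoidx _ _ t') (avoidw _ _ t').
have fourth u v (s r : T) : u \in link x y -> v \in link x y -> s \in link x z -> r \in link x z ->
    adj u v -> u != v -> s != r ->
    exists2 w, (w == s) || (w == r) & uniq [:: x; u; v; w].
  move=> /linkP[xu yu nux nuy] /linkP[xv yv nvx nvy] /linkP[xs zs nsx nsz] /linkP[xr zr nrx nrz].
  move=> uv nuv nsr.
  have Uq w : w != x -> u != w -> v != w -> uniq [:: x; u; v; w].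
    move=> nwx nuw nvw; rewrite /= !inE !negb_or nuv nuw nvw.
    by rewrite eq_sym nux eq_sym nvx eq_sym nwx.
  have [us|nus] := eqVneq u s; last first.
    have [vs|nvs] := eqVneq v s; last by exists s; rewrite ?eqxx //; apply: Uq.
    have [ur|nur] := eqVneq u r; last by exists r; rewrite ?eqxx ?orbT //; apply: Uq; rewrite // vs.
    by clique5_tac x y z u v; rewrite ?ur ?vs // eq_sym.
  have [vr|nvr] := eqVneq v r; last by exists r; rewrite ?eqxx ?orbT //; apply: Uq; rewrite // us.
  by clique5_tac x y z u v; rewrite ?us ?vr // eq_sym.
have trace_z p : p \in trace1 x y z ->
    [/\ s1 \in p, t1 \in p, s2 \notin p & t2 \notin p] \/
    [/\ s1 \notin p, t1 \notin p, s2 \in p & t2 \in p].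
  by rewrite trace1C; apply: trZ.
have glue p q u v : p \in trace1 x y z -> q \in trace1 x y z -> u \in link x y -> v \in link x y ->
    adj u v -> u != v -> u \in p -> v \in p -> u \in q -> v \in q -> p = q.
  move=> pf qf uL vL uv nuv up vp uq vq.
  have [pF pC xp yp zp] := trace1P pf; have [qF qC xq yq zq] := trace1P qf.
  have same (s r : T) : s \in link x z -> r \in link x z -> s != r ->
      s \in p -> r \in p -> s \in q -> r \in q -> p = q.
    move=> sL rL nsr sp rp sq rq; have [w ws Uw] := fourth u v s r uL vL sL rL uv nuv nsr.
    by apply: facet_quad Uw _ _ _ _ _ _ _ _ => //; case/orP: ws => /eqP->.
  have cross (s r : T) p' q' : p' \in facets C -> x \in p' -> s \in link x z -> r \in link x z -> s != r ->
      u \in p' -> v \in p' -> u \in q' -> v \in q' ->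
      s \in p' -> r \in p' -> s \notin q' -> r \notin q' -> False.
    move=> p'C xp' /linkP[_ _ nsx _] /linkP[_ _ nrx _] nsr up' vp' uq' vq' sp' rp' sq' rq'.
    have [/linkP[_ _ nux _] /linkP[_ _ nvx _]] := (uL, vL).
    have [w wuv wsr] := quad_overlap p'C xp' up' vp' sp' rp' nux nvx nsx nrx nuv nsr.
    have wq : w \in q' by case/orP: wuv => /eqP->.
    by case/orP: wsr => /eqP E; move: wq; rewrite E; apply/negP.
  case: (trace_z p pf) (trace_z q qf) => [[h1 h2 h3 h4]|[h1 h2 h3 h4]] [[k1 k2 k3 k4]|[k1 k2 k3 k4]].
  - exact: same s1L t1L nst1 _ _ _ _.
  - by case: (cross s1 t1 p q).
  - by case: (cross s2 t2 p q).
  exact: same s2L t2L nst2 _ _ _ _.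
have le2 : #|trace1 x y z| <= 2.
  have inj : {in trace1 x y z &, injective (fun p : {set T} => u1 \in p)}.
    move=> p q pf qf E.
    have hp := trY _ pf; have hq := trY _ qf.
    have [u1p|u1p] := boolP (u1 \in p).
      have u1q : u1 \in q by rewrite -E.
      case: hp => -[h1 h2 h3 h4]; last by rewrite u1p in h1.
      case: hq => -[k1 k2 k3 k4]; last by rewrite u1q in k1.
      exact: (glue p q u1 v1).
    have u1q : u1 \notin q by rewrite -E.
    case: hp => -[h1 h2 h3 h4]; first by rewrite h1 in u1p.
    case: hq => -[k1 k2 k3 k4]; first by rewrite k1 in u1q.
    exact: (glue p q u2 v2).
  by rewrite -(card_in_imset inj) -card_bool max_card.
have p04 : #|p0| = 4.
  have [p0F p0C xp0 yp0 zp0] := trace1P p0f.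
  apply/eqP; rewrite eqn_leq face_card ?facet_face //=.
  suff [e [f [g [/card_uniqP Uq sub]]]] : exists e f g, uniq [:: x; e; f; g] /\ {subset [:: x; e; f; g] <= p0}.
    by move: Uq; rewrite /= => <-; apply/subset_leq_card/subsetP.
  have pick4 u v (s r : T) : u \in link x y -> v \in link x y -> s \in link x z -> r \in link x z ->
      adj u v -> u != v -> s != r -> u \in p0 -> v \in p0 -> s \in p0 -> r \in p0 ->
      exists e f g, uniq [:: x; e; f; g] /\ {subset [:: x; e; f; g] <= p0}.
    move=> uL vL sL rL uv nuv nsr up vp sp rp.
    have [w ws Uw] := fourth u v s r uL vL sL rL uv nuv nsr.
    exists u, v, w; split=> // e; rewrite !inE => /or4P[] /eqP-> //.
    by case/orP: ws => /eqP->.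
  case: (trY p0 p0f) (trace_z p0 p0f) => [[h1 h2 h3 h4]|[h1 h2 h3 h4]] [[k1 k2 k3 k4]|[k1 k2 k3 k4]];
  by [exact: (pick4 u1 v1 s1 t1)|exact: (pick4 u1 v1 s2 t2)
     |exact: (pick4 u2 v2 s1 t1)|exact: (pick4 u2 v2 s2 t2)].
have [p0F p0C _ _ _] := trace1P p0f.
move: (heavy_trace1_big t) (deg3_gt1 t3 p0C p04) le2; lia_goal.
Qed.

Lemma no_cover3 x y z : triangle x y z -> ~~ cover3 x y z.
Proof.
move=> txyz; apply/negP => cv.
pose P (w : T * T * T) := [&& [&& w.1.1 != w.1.2, w.1.1 != w.2 & w.1.2 != w.2],
  [&& adj w.1.1 w.1.2, adj w.1.1 w.2 & adj w.1.2 w.2] & cover3 w.1.1 w.1.2 w.2].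
have triP a b c : triangle a b c -> cover3 a b c -> P (a, b, c).
  by case=> -[n1 n2 n3] [h1 h2 h3] h; rewrite /P /= n1 n2 n3 h1 h2 h3 h.
have [] := @arg_maxnP _ (x, y, z) P
  (fun w : T * T * T => deg3 w.1.1 w.1.2 w.2) (triP _ _ _ txyz cv).
move=> [[a b] c] /and3P[/= /and3P[n1 n2 n3] /and3P[h1 h2 h3] h] amax.
apply: (@no_heavy a b c); split=> // x' y' z' t' cv'.
exact: (amax (x', y', z') (triP _ _ _ t' cv')).
Qed.

(** * When no triangle meets all members *)

Lemma F_share3 x y z p q : p \in F -> q \in F -> x != y -> x != z -> y != z ->
  x \in p -> y \in p -> z \in p -> x \in q -> y \in q -> z \in q -> p = q.
Proof.
move=> pF qF nxy nxz nyz xp yp zp xq yq zq; apply/eqP/negP => /negP npq.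
have t : triangle x y z by do !split=> //; adj_tac.
by move/negP: (no_cover3 t); apply; apply: share3 pF qF npq _ _ _ _ _ _ _ _ _.
Qed.

Lemma F_share_set (s p q : {set T}) : 2 < #|s| -> p \in F -> q \in F ->
  s \subset p -> s \subset q -> p = q.
Proof.
move=> /card_gt2P[x [y [z [[xs ys zs] [nxy nyz nzx]]]]] pF qF /subsetP sp /subsetP sq.
by apply: (F_share3 (x := x) (y := y) (z := z)); auto; rewrite eq_sym.
Qed.

(** Successively, a vertex, an edge and a triangle of a member do not meet all
members, so this member has a further vertex. *)
Lemma facet_card p : p \in facets C -> #|p| = 4.
Proof.
move=> pC; have /card_gt0P[q qF] : 0 < #|F|.
  by have [v _] := facet_neq0 pC; apply: leq_ltn_trans (Fbig v).
rewrite (Cpure pC (FF qF)); apply/eqP; rewrite eqn_leq face_card ?facet_face ?FF //=.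
have [x xq] := facet_neq0 (FF qF).
have xx : adj x x := facet_adj (FF qF) xq xq.
have [r1 [r1F xr1 _]] := no_cover2 xx; have [y yq yr1] := F_meet qF r1F.
have xy : adj x y by adj_tac.
have [r2 [r2F xr2 yr2]] := no_cover2 xy; have [z zq zr2] := F_meet qF r2F.
have nxy : x != y by neq_tac.
have nxz : x != z by neq_tac.
have nyz : y != z by neq_tac.
have t : triangle x y z by do !split=> //; adj_tac.
have /forall_inPn[r3 r3F] := no_cover3 t; rewrite !negb_or => /and3P[xr3 yr3 zr3].
have [w wq wr3] := F_meet qF r3F.
have Us : uniq [:: x; y; z; w].
  by rewrite /= !inE !negb_or andbT; do ![apply/andP; split]; neq_tac.
have := card_uniqP Us; rewrite /= => <-; apply/subset_leq_card/subsetP => e.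
by rewrite !inE => /or4P[] /eqP->.
Qed.

Definition Fdeg2 x c := #|[set p in F | (x \in p) && (c \in p)]|.
Definition Fdeg x := #|[set p in F | x \in p]|.

(** The members through [xc] meet one that misses [xc] in one of two vertices of
the link, and three vertices determine a member. *)
Lemma Fdeg2_le2 x c : x != c -> Fdeg2 x c <= 2.
Proof.
move=> nxc; rewrite /Fdeg2; set A := [set p in F | _].
have [->|/set0Pn[p0]] := eqVneq A set0; first by rewrite cards0.
rewrite inE => /and3P[p0F xp0 cp0].
have xc : adj x c by adj_tac.
have [q [qF xq cq]] := no_cover2 xc.
have meet p : p \in A -> exists e, [/\ e \in p, e \in q & e \in link x c].
  rewrite inE => /and3P[pF xp cp]; have [e ep eq] := F_meet pF qF.
  by exists e; split=> //; apply/linkP; split; try adj_tac; neq_tac.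
have p0A : p0 \in A by rewrite inE p0F xp0 cp0.
have [u [up0 uq uL]] := meet _ p0A.
have [v [vq vL tr]] := trace_le2 (FF qF) nxc xc uq uL.
have same e p r : e \in link x c -> p \in A -> r \in A -> e \in p -> e \in r -> p = r.
  move=> /linkP[_ _ nex nec]; rewrite !inE => /and3P[pF xp cp] /and3P[rF xr cr] ep er.
  by apply: (F_share3 (x := x) (y := c) (z := e)); rewrite // eq_sym.
have hit p : p \in A -> u \notin p -> v \in p.
  move=> /meet[e [ep eq eL]] up; case: (tr _ eq eL) => E; last by rewrite -E.
  by rewrite -E ep in up.
have inj : {in A &, injective (fun p : {set T} => u \in p)}.
  move=> p r pA rA E; have [up|up] := boolP (u \in p).
    by apply: (same u) => //; rewrite -E.
  by apply: (same v) => //; apply: hit; rewrite -?E.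
by rewrite -(card_in_imset inj) -card_bool max_card.
Qed.

Lemma sum_hits (A : {set {set T}}) (s : {set T}) :
  \sum_(e in s) #|[set p in A | e \in p]| = \sum_(p in A) #|p :&: s|.
Proof.
transitivity (\sum_(e in s) \sum_(p in A | e \in p) 1).
  by apply: eq_bigr => e _; rewrite -sum1_card; apply: eq_bigl => p; rewrite inE.
rewrite (exchange_big_dep (fun p => p \in A)) //=; last by move=> ? ? _ /andP[].
apply: eq_bigr => p pA; rewrite -sum1_card; apply: eq_bigl => e.
by rewrite inE pA andbC.
Qed.

Lemma card_hits (A : {set {set T}}) (s : {set T}) (m : nat) :
    {in A, forall p, exists2 e, e \in p & e \in s} ->
    {in s, forall e, #|[set p in A | e \in p]| <= m} ->
  #|A| <= #|s| * m.
Proof.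
move=> hit le_m; rewrite -sum_nat_const -sum1_card.
apply: (@leq_trans (\sum_(p in A) #|p :&: s|)).
  apply: leq_sum => p /hit[e ep es]; apply/card_gt0P; exists e.
  by rewrite inE ep.
by rewrite -sum_hits; apply: leq_sum.
Qed.

Definition nbr x := [set e | adj x e && (e != x)].

Lemma nbr_card x p : p \in facets C -> x \notin p -> #|p :&: nbr x| <= 3.
Proof.
move=> pC xp; have [->|/set0Pn[e]] := eqVneq (p :&: nbr x) set0.
  by rewrite cards0.
rewrite !inE => /and3P[ep xe _].
have : x |: (p :&: nbr x) \in C.
  apply: clique_face => a b; rewrite !inE.
  have xx : adj x x by apply: (face_adj xe); rewrite !inE eqxx.
  by move=> /predU1P[->|/and3P[ap xa _]] /predU1P[->|/and3P[bp xb _]] //; adj_tac.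
by move/face_card; rewrite cardsU1 !inE (negPf xp) add1n.
Qed.

Lemma Fdeg_le x p m : p \in F -> x \notin p ->
  {in p :&: nbr x, forall c, Fdeg2 x c <= m} -> Fdeg x <= #|p :&: nbr x| * m.
Proof.
move=> pF xp le_m; apply: card_hits => [q|e /le_m].
  rewrite inE => /andP[qF xq]; have [e eq ep] := F_meet qF pF.
  by exists e; rewrite // !inE ep /=; apply/andP; split; [adj_tac | neq_tac].
by congr (_ <= _); apply: eq_card => q; rewrite !inE andbA.
Qed.

Section Injection.

Variable x : T.

(** The members avoiding [x] are to be mapped injectively to the facets through [x]
outside [F].  A member with three neighbours of [x] goes to the facet that these
form with [x].  A member with only two has a choice, and competes with at most
one other member through the same two vertices, while there are at least two
facets to choose from.  [trace_key] names the pair or triple that is used, on both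
sides, so that it is enough to compare its fibres. *)
Definition short_traces : {set {set T}} :=
  [set g : {set T} | [exists p in F, [&& x \notin p, g == p :&: nbr x & #|g| == 2]]].

Definition trace_key (s : {set T}) :=
  if [pick g in short_traces | g \subset s] is Some g then g else s :&: nbr x.

Lemma trace_key_sub s : trace_key s \subset s.
Proof.
by rewrite /trace_key; case: pickP => [g /andP[]//|_]; apply: subsetIl.
Qed.

Hypothesis traces : forall p, p \in F -> x \notin p ->
  #|p :&: nbr x| = 3 \/ #|p :&: nbr x| = 2 /\ 3 < Fdeg x.

Lemma short_traceP g : g \in short_traces ->
  exists a b, [/\ g = [set a; b], a != b, triangle x a b, 3 < Fdeg x &
     {in F, forall p, x \in p -> (a \in p) || (b \in p)}].
Proof.
rewrite inE => /exists_inP[p pF /and3P[xp /eqP gE g2]].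
have [E|[_ big]] := traces pF xp; first by move: g2; rewrite gE E.
have /cards2P[a [b [nab gab]]] := g2; exists a, b.
have inter e : e \in g -> [/\ e \in p, adj x e & e != x].
  by rewrite gE !inE => /and3P[].
have [ap xa nax] : [/\ a \in p, adj x a & a != x] by apply: inter; rewrite gab !inE eqxx.
have [bp xb nbx] : [/\ b \in p, adj x b & b != x].
  by apply: inter; rewrite gab !inE eqxx orbT.
have ab : adj a b by adj_tac.
split=> //; first by do !split; rewrite // eq_sym.
move=> q qF xq; have [e eq ep] := F_meet qF pF.
have : e \in g by rewrite gE !inE ep /=; apply/andP; split; [adj_tac|neq_tac].
by rewrite gab !inE => /orP[] /eqP <-; rewrite eq ?orbT.
Qed.

(** Every member through [x] meets the pair, and each of the two vertices accounts
for two of them at most; one that contains both would leave only three. *)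
Lemma short_trace_notin g p : g \in short_traces -> p \in F -> x \in p ->
  ~~ (g \subset p).
Proof.
move=> /short_traceP[a [b [-> nab [[nxa nxb _] _] big hit]]] pF xp.
apply/negP => /subsetP gp.
have [ap bp] : a \in p /\ b \in p by split; apply: gp; rewrite !inE eqxx ?orbT.
move: big; rewrite ltnNge => /negP[].
pose X e := [set q in F | (x \in q) && (e \in q)].
have pX e : e \in p -> p \in X e by move=> ep; rewrite inE pF xp.
have sub : [set q in F | x \in q] \subset p |: (X a :\ p :|: X b :\ p).
  apply/subsetP => q; rewrite !inE => /andP[qF xq]; rewrite qF xq /=.
  by case: eqVneq => //= _; rewrite hit.
have := subset_leq_card sub; rewrite cardsU1.
have := Fdeg2_le2 nxa; have := Fdeg2_le2 nxb.
rewrite /Fdeg2 -/(X a) -/(X b) (cardsD1 p (X a)) (cardsD1 p (X b)) !pX //.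
rewrite cardsU /Fdeg; case: (p \notin _) => /=;
  move: #|X a :\ p| #|X b :\ p| #|_ :&: _| #|[set q in F | x \in q]| => m n k f; lia_goal.
Qed.

(** Inside the facet [p] the pairs would share a vertex [e]; members through [x] that
avoid [e] then contain the other two vertices, so there is at most
one, and at most three members through [x] in all. *)
Lemma short_trace_unique g h p : g \in short_traces -> h \in short_traces ->
  p \in facets C -> x \in p -> g \subset p -> h \subset p -> g = h.
Proof.
move=> gS hS pC xp gp hp; apply/eqP/negP => /negP ngh.
have [a [b [gE nab [[nxa nxb _] _] big hit]]] := short_traceP gS.
have [c [d [hE ncd [[nxc nxd _] _] _ hit']]] := short_traceP hS.
have share e g1 g2 : e != x -> g1 != x -> g2 != x -> g1 != g2 ->
   {in F, forall p, x \in p -> (e \in p) || (g1 \in p)} ->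
   {in F, forall p, x \in p -> (e \in p) || (g2 \in p)} -> False.
  move=> nex nf1 nf2 n12 h1 h2; move: big; rewrite ltnNge => /negP[].
  pose X := [set q in F | (x \in q) && (e \in q)].
  pose Y := [set q in F | [&& x \in q, g1 \in q & g2 \in q]].
  have sub : [set q in F | x \in q] \subset X :|: Y.
    apply/subsetP => q; rewrite !inE => /andP[qF xq]; rewrite qF xq /=.
    by move: (h1 _ qF xq) (h2 _ qF xq); case: (e \in q) => //= -> ->.
  have Y1 : #|Y| <= 1.
    apply/card_le1_eqP => q r; rewrite !inE => /and4P[qF xq q1 q2] /and4P[rF xr r1 r2].
    by apply: (F_share3 (x := x) (y := g1) (z := g2)); rewrite // eq_sym.
  have X2 : #|X| <= 2 by apply: Fdeg2_le2; rewrite eq_sym.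
  by move: (subset_leq_card sub) Y1 X2; rewrite cardsU /Fdeg; lia_goal.
have [ap bp] : a \in p /\ b \in p.
  by split; apply: (subsetP gp); rewrite gE !inE eqxx ?orbT.
have [cp dp] : c \in p /\ d \in p.
  by split; apply: (subsetP hp); rewrite hE !inE eqxx ?orbT.
move: ngh; rewrite gE hE.
have flipor (u v : T) : {in F, forall p, x \in p -> (u \in p) || (v \in p)} ->
     {in F, forall p, x \in p -> (v \in p) || (u \in p)}.
  by move=> hq q qF xq; rewrite orbC hq.
have [Eac|nac] := eqVneq a c.
  subst c => ngh; apply: (share a b d) => //; rewrite 1?eq_sym //.
  by apply: contraNneq ngh => ->.
have [Ead|nad] := eqVneq a d.
  subst d => ngh; apply: (share a b c); rewrite // 1?eq_sym //; last exact: flipor.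
  by apply: contraNneq ngh => ->; rewrite setUC.
have [Ebc|nbc] := eqVneq b c.
  subst c => _; apply: (share b a d); rewrite // 1?eq_sym //; exact: flipor.
have [Ebd|nbd] := eqVneq b d.
  subst d => _; apply: (share b a c); rewrite // 1?eq_sym //; exact: flipor.
by move=> _; clique5_tac x a b c d.
Qed.

Lemma in_facets_at p y : (p \in facets_at C y) = (p \in facets C) && (y \in p).
Proof. exact: in_set. Qed.

Lemma trace_injection : False.
Proof.
pose A := [set p in F | x \notin p].
pose B := [set p in facets C | (x \in p) && (p \notin F)].
have nbrx : x \notin nbr x by rewrite inE eqxx andbF.
have short_nbr g : g \in short_traces -> g \subset nbr x.
  by rewrite inE => /exists_inP[p _ /and3P[_ /eqP-> _]]; apply: subsetIr.
have le_fib k : #|[set p in A | trace_key p == k]| <= #|[set q in B | trace_key q == k]|.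
  have [->|/set0Pn[p]] := eqVneq [set p in A | trace_key p == k] set0.
    by rewrite cards0.
  rewrite inE => /andP[]; rewrite inE => /andP[pF xp] /eqP pk.
  have fibA q : q \in [set p in A | trace_key p == k] -> q \in F /\ k \subset q.
    rewrite inE => /andP[]; rewrite inE => /andP[qF _] /eqP <-.
    by split=> //; apply: trace_key_sub.
  move: (pk); rewrite {1}/trace_key; case: pickP => [g /andP[gS gp] gk|none kE].
    rewrite {g}gk in gS gp.
    have [a [b [kab nab tab big hit]]] := short_traceP gS.
    have [[nxa nxb _] _] := tab.
    apply: (@leq_trans 2).
      apply: leq_trans (Fdeg2_le2 nab); apply/subset_leq_card/subsetP => q /fibA[qF].
      by rewrite inE qF kab => /subsetP kq; rewrite !kq // !inE eqxx ?orbT.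
    apply: leq_trans (deg3_gt1 tab (FF pF) (facet_card (FF pF))) _.
    apply/subset_leq_card/subsetP => q; rewrite inE => /and4P[qC xq aq bq].
    have kq : k \subset q by rewrite kab; apply/subsetP => e; rewrite !inE => /orP[] /eqP->.
    have qF : q \notin F by apply/negP => qF; move/negP: (short_trace_notin gS qF xq).
    rewrite inE; apply/andP; split; first by rewrite inE qC xq qF.
    rewrite /trace_key; case: pickP => [g /andP[gS' gq]|/(_ k)]; last by rewrite gS kq.
    by apply/eqP/(short_trace_unique gS' gS qC).
  have k3 : #|k| = 3.
    have [E|[E _]] := traces pF xp; rewrite -?kE ?E //.
    have : p :&: nbr x \in short_traces.
      by rewrite inE; apply/exists_inP; exists p; rewrite // xp eqxx E.
    by move=> S; have := none (p :&: nbr x); rewrite S subsetIl.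
  apply: (@leq_trans 1).
    apply/card_le1_eqP => q r /fibA[qF kq] /fibA[rF kr].
    by apply: (F_share_set (s := k)); rewrite ?k3.
  have kp : k \subset p by rewrite -kE subsetIl.
  have xk : x \notin k by apply: contra xp; apply: (subsetP kp).
  have xkC : x |: k \in C.
    have xadj e : e \in k -> adj x e by rewrite -kE !inE => /and3P[].
    have [e ek] : exists e, e \in k by apply/card_gt0P; rewrite k3.
    have xx : adj x x by apply: (face_adj (xadj _ ek)); rewrite !inE eqxx.
    apply: clique_face => a b; rewrite !inE.
    move=> /predU1P[->|ak] /predU1P[->|bk] //; [exact: xadj | |].
      by rewrite adjC; apply: xadj.
    by apply: (facet_adj (FF pF)); apply: (subsetP kp).
  have xkF : x |: k \in facets C by apply: card4_facet; rewrite // cardsU1 xk k3.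
  apply/card_gt0P; exists (x |: k); rewrite inE; apply/andP; split.
    rewrite inE xkF setU11 /=; apply/negP => xkm.
    have E : x |: k = p by apply: (F_share_set (s := k)); rewrite ?k3 // subsetUr.
    by move: xp; rewrite -E setU11.
  rewrite /trace_key; case: pickP => [g /andP[gS gxk]|_].
    have := none g; rewrite gS /= => /negP[]; apply: subset_trans kp.
    apply/subsetP => e eg; have := subsetP gxk _ eg; rewrite !inE.
    by case/predU1P => // ex; case/negP: nbrx; rewrite -{1}ex (subsetP (short_nbr _ gS)).
  apply/eqP/setP => e; rewrite in_setI in_setU1; have [->|nex] := eqVneq e x.
    by rewrite (negPf nbrx) (negPf xk).
  apply/andP/idP => [[]//|ek]; split=> //.
  by move: ek; rewrite -kE inE => /andP[].
have AB : #|A| <= #|B| by apply: card_le_fibers le_fib.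
have := Fbig x; rewrite (card_split x F) ltnNge => /negP[].
have -> : #|facets_at C x| = #|[set p in F | x \in p]| + #|B|.
  rewrite -(cardsID F); congr (_ + _); apply: eq_card => p.
    rewrite in_setI in_facets_at [in RHS]in_set.
    by have [pF|] := boolP (p \in F); rewrite ?andbF // FF ?andbT.
  by rewrite in_setD in_facets_at [in RHS]in_set andbC andbA.
by rewrite leq_add2l.
Qed.

End Injection.

Lemma short_trace_ex x : exists p, [/\ p \in F, x \notin p &
  #|p :&: nbr x| <= 1 \/ #|p :&: nbr x| = 2 /\ Fdeg x <= 3].
Proof.
have [/exists_inP[p pF /andP[xp h]]|none] := boolP [exists p in F, (x \notin p) &&
   ((#|p :&: nbr x| <= 1) || (#|p :&: nbr x| == 2) && (Fdeg x <= 3))].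
  exists p; split=> //; case/orP: h => [?|/andP[/eqP ? ?]]; [by left | by right].
case: (@trace_injection x) => p pF xp.
have := nbr_card (FF pF) xp.
move: none; rewrite negb_exists_in => /forall_inP/(_ p pF).
rewrite xp /= negb_or negb_and -!ltnNge.
case: #|_| => [|[|[|[|n]]]] //=; [by right | by left].
Qed.

Lemma Fdeg_le3 x : Fdeg x <= 3.
Proof.
have [p [pF xp [le1|[_ //]]]] := short_trace_ex x.
have : Fdeg x <= #|p :&: nbr x| * 2.
  apply: Fdeg_le => // c; rewrite !inE => /and3P[_ _ ncx].
  by apply: Fdeg2_le2; rewrite eq_sym.
by move=> h; apply: leq_trans h _; apply: (@leq_trans (1 * 2)); rewrite // leq_mul2r le1.
Qed.

Definition star (s : {set T}) := [set p in facets C | s \subset p].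

Lemma star_half s a : a \notin s -> {in s, forall e, adj a e} ->
  #|star (a |: s)|.*2 <= #|star s|.
Proof.
move=> as' adja; rewrite (card_split a (star s)) -addnn.
have -> : [set p in star s | a \in p] = star (a |: s).
  apply/setP => p; rewrite inE ![_ \in star _]inE subUset sub1set -andbA.
  by congr (_ && _); apply: andbC.
rewrite leq_add2l; apply: (@flip_count a) => p.
rewrite inE subUset sub1set => /and3P[pC ap /subsetP sp].
split=> //; rewrite inE flip_notin // andbT inE flip_facet //=.
apply/subsetP => e es; rewrite flip_mem ?(sp e) ?(adja e) //.
exact: (neq_in es as').
Qed.

(** Facets have four vertices, and by [star_half] the star of a face at least doubles
with each vertex removed from it. *)
Lemma F_card_gt8 : 8 < #|F|.
Proof.
have [v vC] := Ccx.2; have [p pC vp] : exists2 p, p \in facets C & v \in p.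
  have : [set v] \in C by move: vC; rewrite inE.
  by case/face_in_facet => p pC; rewrite sub1set; exists p.
apply: leq_ltn_trans (Fbig v).
have -> : facets_at C v = star [set v] by apply/setP => q; rewrite !inE sub1set.
have grow n s : s \subset p -> v \in s -> #|s| + n = 4 -> 2 ^ n <= #|star s|.
  elim: n s => [|n IHn] s sp vs sn.
    by apply/card_gt0P; exists p; rewrite inE pC sp.
  have [a ap as'] : exists2 a, a \in p & a \notin s.
    apply/subsetPn/negP => /subset_leq_card; rewrite facet_card //.
    by move: sn; clear; lia.
  have h : 2 ^ n <= #|star (a |: s)|.
    apply: IHn; first by rewrite subUset sub1set ap sp.
      by rewrite setU1r.
    by rewrite cardsU1 as' add1n -sn addnS.
  rewrite expnS mul2n; apply: leq_trans (star_half as' _); first by rewrite leq_double.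
  by move=> e es; apply: (facet_adj pC ap); apply: (subsetP sp).
by apply: (grow 3); rewrite ?sub1set ?set11 ?cards1.
Qed.

(** Each of the four vertices of [p] lies in at most two other members.  A member
that is counted twice leaves at most seven others, hence eight members in all, against
[F_card_gt8]. *)
Lemma F_inter1 p q x y : p \in F -> q \in F -> x != y ->
  x \in p -> x \in q -> y \in p -> y \in q -> p = q.
Proof.
move=> pF qF nxy xp xq yp yq; apply/eqP/negP => /negP npq.
have := F_card_gt8; rewrite (cardsD1 p) pF add1n ltnS => F8.
have : \sum_(e in p) #|[set r in F :\ p | e \in r]| <= 4 * 2.
  rewrite -(facet_card (FF pF)) -sum_nat_const; apply: leq_sum => e ep.
  have := Fdeg_le3 e; rewrite /Fdeg (cardsD1 p) inE pF ep add1n ltnS.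
  apply: leq_trans; apply/subset_leq_card/subsetP => r.
  by rewrite !inE => /andP[/andP[-> ->] ->].
rewrite sum_hits leqNgt => /negP[].
rewrite (bigD1 q) /=; last by rewrite !inE eq_sym npq.
have q2 : 2 <= #|q :&: p|.
  by apply/card_gt1P; exists x, y; rewrite !inE xp xq yp yq.
have qp : q \in F :\ p by rewrite !inE eq_sym npq.
apply: (@leq_trans (2 + #|F :\ p :\ q|)).
  by move: F8; rewrite (cardsD1 q) qp add1n ltnS add2n.
apply: leq_add => //; rewrite -sum1_card.
rewrite (eq_bigl (fun i => (i \in F :\ p) && (i != q))); last first.
  by move=> r; rewrite [LHS]inE andbC in_set1.
apply: leq_sum => r; rewrite !inE => /andP[/andP[_ rF] _].
by have [e er ep] := F_meet rF pF; apply/card_gt0P; exists e; rewrite inE er.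
Qed.

Lemma Fdeg_le2 x : Fdeg x <= 2.
Proof.
have [p [pF xp short]] := short_trace_ex x.
apply: (@leq_trans (#|p :&: nbr x| * 1)); last by rewrite muln1; lia.
apply: Fdeg_le => // c; rewrite !inE => /and3P[_ _ ncx].
apply/card_le1_eqP => q r; rewrite !inE => /and3P[qF xq cq] /and3P[rF xr cr].
by apply: (F_inter1 (x := x) (y := c)); rewrite // eq_sym.
Qed.

Lemma no_big_family : False.
Proof.
have := F_card_gt8; have /card_gt0P[p pF] : 0 < #|F| by apply: leq_trans F_card_gt8.
rewrite ltnNge => /negP[].
apply: (@leq_trans (#|p| * 2)); last by rewrite facet_card ?FF.
by apply: card_hits => [q qF|e _]; [apply: F_meet | apply: Fdeg_le2].
Qed.

End MaxFamily.
End FlagComplex.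

Theorem theorem1p7 (T : finType) (C : {set {set T}}) :
  simplicial_complex C -> pure C -> flag C -> without_boundary C ->
  dim C <= 3 -> pure_EKR C.
Proof.
move=> Ccx Cpure Cflag Cnb Cdim; have [subC [v0 v0C]] := Ccx.
have [v _ vmax] := @arg_maxnP _ v0 predT (fun v => #|facets_at C v|) isT.
have [p0 p0C v0p0] : exists2 p, p \in facets C & v0 \in p.
  have : [set v0] \in C by move: v0C; rewrite inE.
  by case/face_in_facet => p pC; rewrite sub1set; exists p.
have degv : 0 < #|facets_at C v|.
  by apply: leq_trans (vmax v0 isT); apply/card_gt0P; exists p0; rewrite inE p0C v0p0.
exists v.
  case/card_gt0P: degv => p; rewrite inE => /andP[pC vp].
  by rewrite inE; apply: (subC p); rewrite ?sub1set // facet_face.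
move=> F0 F0C F0int; rewrite leqNgt; apply/negP => big.
pose P (F : {set {set T}}) := (F \subset facets C) &&
  [forall p in F, forall q in F, (p != q) ==> ~~ [disjoint p & q]].
have PP (F : {set {set T}}) : reflect (F \subset facets C /\ intersecting F) (P F).
  apply: (iffP andP) => -[FC h]; split=> //.
    by move=> p q pF qF; move/forall_inP/(_ p pF)/forall_inP/(_ q qF)/implyP: h.
  by apply/forall_inP => p pF; apply/forall_inP => q qF; apply/implyP; apply: h.
have [F /PP[FC Fint] Fmax] :=
  @arg_maxnP _ F0 P (fun F : {set {set T}} => #|F|) (introT (PP F0) (conj F0C F0int)).
apply: (@no_big_family T C Ccx Cpure Cflag Cnb Cdim F) => //; first exact/subsetP.
  by move=> F' F'C F'int; apply: Fmax; apply/PP.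
move=> w; apply: leq_ltn_trans (vmax w isT) _; apply: leq_trans big _.
by apply: Fmax; apply/PP.
Qed.
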